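(* For every integer $n\ge1$ there is a constant $C>0$, depending only on $n$, such that for every $\ell\ge 0$ and every closed set $\Lambda\subset\mathbb{S}^n$ whose convex hull $H(\Lambda)\subset\mathbb{B}^{n+1}$ is $\ell$-tight, one has $$h_c(\Lambda)=\overline{\dim}_B(\Lambda)\leq n-C\,e^{-2n\ell}.$$
   Context: $(\mathbb{B}^{n+1},d)$ is the unit ball model of $(n+1)$-dimensional hyperbolic space, with boundary at infinity the unit sphere $\mathbb{S}^n$; $\mathrm{vol}$ is hyperbolic volume and $B_R(z)$ the hyperbolic ball of centre $z$ and radius $R$. For a closed set $\Lambda\subset\mathbb{S}^n$, the convex hull $H(\Lambda)\subset\mathbb{B}^{n+1}$ is the hyperbolic convex hull of the union of all geodesics both of whose end points lie in $\Lambda$; $\partial H(\Lambda)$ is its boundary in $\mathbb{B}^{n+1}$, and $H_\varepsilon(\Lambda)$ is its $\varepsilon$-neighbourhood, $\varepsilon>0$. $H(\Lambda)$ is $\ell$-tight if every point $z\in H(\Lambda)$ is within distance $\ell$ from $\partial H(\Lambda)$. The convex core entropy of $\Lambda$ is $$h_c(\Lambda)=\limsup_{R\to\infty}\frac{\log \mathrm{vol}(B_R(z)\cap H_\varepsilon(\Lambda))}{R},$$ which is independent of $z\in\mathbb{B}^{n+1}$ and of $\varepsilon>0$. It satisfies $0\le h_c(\Lambda)\le n$; for $\Lambda$ with at most one point (empty hull) $h_c(\Lambda)$ is taken to be $0$, and the dimension of the empty set is taken to be $0$. $\overline{\dim}_B$ is the upper box-counting dimension with respect to the spherical metric on $\mathbb{S}^n$.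 *)

(* Defs.v *)
From HB Require Import structures.
From mathcomp Require Import all_boot all_order all_algebra.
From mathcomp Require Import all_classical all_reals all_analysis.

Set Implicit Arguments.
Unset Strict Implicit.
Unset Printing Implicit Defensive.

Import Order.TTheory GRing.Theory Num.Theory.
Import numFieldNormedType.Exports.

Local Open Scope classical_set_scope.
Local Open Scope ring_scope.

Section ConsPair.
Context {d} {T : measurableType d} {m : nat}.

Definition cons_pair (x : T * m.-tuple T) : m.+1.-tuple T := [tuple of x.1 :: x.2].

Definition uncons_pair (t : m.+1.-tuple T) : T * m.-tuple T :=
  (thead t, [tuple of behead t]).

Lemma cons_pairK : cancel cons_pair uncons_pair.
Proof.
move=> [x t]; rewrite /uncons_pair /cons_pair/= theadE; congr pair.
exact: val_inj.
Qed.

Lemma measurable_cons_pair : measurable_fun setT cons_pair.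
Proof. by apply: measurable_cons; [exact: measurable_fst|exact: measurable_snd]. Qed.

Lemma measurable_uncons_pair : measurable_fun setT uncons_pair.
Proof.
by apply/measurable_fun_pair; [exact: measurable_tnth|exact: measurable_behead].
Qed.

Section SigmaFinite.
Context {R : realType}.
Variable mu1 : {sigma_finite_measure set T -> \bar R}.
Variable mu2 : {sigma_finite_measure set (m.-tuple T) -> \bar R}.
Local Open Scope ereal_scope.

Let mu : {measure set (T * m.-tuple T)%type -> \bar R} := mu1 \x mu2.

Let nu : set (m.+1.-tuple T) -> \bar R := pushforward mu cons_pair.

Let nu0 : nu set0 = 0.
Proof. by rewrite /nu /pushforward preimage_set0 measure0. Qed.

Let nu_ge0 A : 0 <= nu A.
Proof. exact: (measure_ge0 mu (cons_pair @^-1` A)). Qed.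

Let nu_sigma_additive : semi_sigma_additive nu.
Proof.
exact: (@measure_semi_sigma_additive _ _ _
  (measure_function_pushforward__canonical__measure_function_Measure
     mu measurable_cons_pair)).
Qed.

Let nu_sigma_finite : sigma_finite setT nu.
Proof.
have /sigma_finiteP[F [TF ndF Foo]] := sigma_finiteT mu1.
have /sigma_finiteP[G [TG ndG Goo]] := sigma_finiteT mu2.
exists (fun i => uncons_pair @^-1` (F i `*` G i)) => [|i].
  rewrite -preimage_bigcup (_ : \bigcup_i (F i `*` G i) = setT) ?preimage_setT//.
  rewrite predeqE => -[x y]; split=> // _.
  have [k _ Fkx] : (\bigcup_i F i) x by rewrite -TF.
  have [l _ Gly] : (\bigcup_i G i) y by rewrite -TG.
  exists (maxn k l) => //; split.
  - by move: x Fkx; exact/subsetPset/ndF/leq_maxl.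
  - by move: y Gly; exact/subsetPset/ndG/leq_maxr.
have [mF Fi] := Foo i; have [mG Gi] := Goo i.
have mFG : measurable (F i `*` G i) by exact: measurableX.
split; first by rewrite -[X in measurable X]setTI; exact: measurable_uncons_pair.
rewrite /nu /pushforward -comp_preimage.
have -> : uncons_pair \o cons_pair = id by apply/funext; exact: cons_pairK.
by rewrite /= product_measure1E// lte_mul_pinfty// ge0_fin_numE.
Qed.

HB.instance Definition _ := isMeasure.Build _ _ _ nu nu0 nu_ge0 nu_sigma_additive.
HB.instance Definition _ := Measure_isSigmaFinite.Build _ _ _ nu nu_sigma_finite.

Lemma pushforward_cons_pair_sigma_finite :
  exists nu' : {sigma_finite_measure set (m.+1.-tuple T) -> \bar R},
    nu' = pushforward (mu1 \x mu2) cons_pair :> (_ -> _).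
Proof. by exists nu. Qed.

End SigmaFinite.
End ConsPair.

Section LebesgueTuple.
Context {R : realType}.
Local Open Scope ereal_scope.
Local Notation tupleR m := (m.-tuple (measurableTypeR R)).

(* Lebesgue measure on R^m. *)
Fixpoint lebesgue_tuple (m : nat) : set (tupleR m) -> \bar R :=
  match m with
  | 0%N => \d_([tuple] : tupleR 0)
  | m'.+1 => pushforward (lebesgue_measure \x @lebesgue_tuple m') cons_pair
  end.

Let lebesgue_tupleE m :
  exists mu : {sigma_finite_measure set (tupleR m) -> \bar R},
    mu = @lebesgue_tuple m :> (_ -> _).
Proof.
elim: m => [|m [mu muE]] /=; first by exists \d_([tuple] : tupleR 0).
by rewrite -muE; exact: pushforward_cons_pair_sigma_finite.
Qed.

Variable m : nat.

Let lebesgue_tuple0 : @lebesgue_tuple m set0 = 0.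
Proof. by have [mu <-] := lebesgue_tupleE m. Qed.

Let lebesgue_tuple_ge0 A : 0 <= @lebesgue_tuple m A.
Proof. by have [mu <-] := lebesgue_tupleE m. Qed.

Let lebesgue_tuple_sigma_additive : semi_sigma_additive (@lebesgue_tuple m).
Proof.
by have [mu <-] := lebesgue_tupleE m; exact: measure_semi_sigma_additive.
Qed.

Let lebesgue_tuple_sigma_finite : sigma_finite setT (@lebesgue_tuple m).
Proof. by have [mu <-] := lebesgue_tupleE m; exact: sigma_finiteT. Qed.

HB.instance Definition _ := isMeasure.Build _ _ _ (@lebesgue_tuple m)
  lebesgue_tuple0 lebesgue_tuple_ge0 lebesgue_tuple_sigma_additive.
HB.instance Definition _ := Measure_isSigmaFinite.Build _ _ _ (@lebesgue_tuple m)
  lebesgue_tuple_sigma_finite.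

End LebesgueTuple.

Section HyperbolicBall.
Context {R : realType} {m : nat}.
Implicit Types (x y z xi eta : 'rV[R]_m) (A L : set 'rV[R]_m).

Definition dotr x y : R := \sum_i x 0 i * y 0 i.

(* The library norm on 'rV[R]_m is the sup norm, hence these explicit
   Euclidean definitions; both norms induce the same topology. *)
Definition uball : set 'rV[R]_m := [set x | dotr x x < 1].

Definition usphere : set 'rV[R]_m := [set x | dotr x x = 1].

Definition arcosh (t : R) : R := ln (t + Num.sqrt (t ^+ 2 - 1)).

(* Poincare metric of curvature -1 (meaningful for x, y in uball). *)
Definition hdist x y : R :=
  arcosh (1 + 2 * dotr (x - y) (x - y) / ((1 - dotr x x) * (1 - dotr y y))).

Definition hball z (r : R) : set 'rV[R]_m := [set x | uball x /\ hdist z x < r].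

Definition hnbhd (e : R) A : set 'rV[R]_m :=
  [set x | uball x /\ exists2 y, A y & hdist x y < e].

(* Integral of the density of the Riemannian metric 4 |dx|^2 / (1 - |x|^2)^2. *)
Definition hvol A : \bar R :=
  \int[@lebesgue_tuple R m]_(t in [set t : m.-tuple (measurableTypeR R) | A (\row_i tnth t i)])
    let x := \row_i tnth t i in ((2 / (1 - dotr x x)) ^+ m)%:E.

Definition geodesic_line (g : R -> 'rV[R]_m) : Prop :=
  (forall t, uball (g t)) /\ (forall s t, hdist (g s) (g t) = `|s - t|).

(* Every geodesic segment of the hyperbolic space is an arc of a geodesic line. *)
Definition hconvex A : Prop :=
  A `<=` uball /\ forall g, geodesic_line g -> is_interval (g @^-1` A).

Definition geodesics_with_ends_in L : set 'rV[R]_m :=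
  [set x | exists g xi eta, [/\ geodesic_line g, L xi /\ L eta,
     g t @[t --> -oo] --> xi, g t @[t --> +oo] --> eta & range g x]].

Definition hull L : set 'rV[R]_m := smallest hconvex (geodesics_with_ends_in L).

Definition hboundary A : set 'rV[R]_m := (closure A `\` A°) `&` uball.

Definition tight (l : R) L : Prop :=
  forall z, hull L z -> exists2 w, hboundary (hull L) w & hdist z w <= l.

Definition convex_core_entropy z (e : R) L : \bar R :=
  if `[< hull L = set0 >] then 0%E else
  limf_esup
    (fun r : R => lne (hvol (hball z r `&` hnbhd e (hull L))) * (r^-1)%:E)%E
    (pinfty_nbhs R).

Definition sdist x y : R := acos (dotr x y).

Definition covering_number (d : R) L : \bar R :=
  ereal_inf [set ((size s)%:R)%:E | s in [set s : seq 'rV[R]_m |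
    (forall c, c \in s -> usphere c) /\
    (forall x, L x -> exists2 c, c \in s & sdist c x < d)]].

Definition upper_box_dim L : \bar R :=
  if `[< L = set0 >] then 0%E else
  limf_esup (fun d : R => lne (covering_number d L) * ((- ln d)^-1)%:E)%E 0^'+.

End HyperbolicBall.

(* Main.v *)
(* Entropy and dimension.  A point of the e-neighbourhood of the hull at Euclidean
   depth t = 1 - |x| lies within O(t) of the limit set, and conversely over every
   limit point there are hull points at every small depth.  Hence the part of that
   neighbourhood at depth about t is comparable with the union of N(t) balls of
   radius t, each of bounded hyperbolic volume, and summing over dyadic depths gives
   N(C e^-r) / C <= vol <= C (r + 1) N(e^-r / C).

   Dimension bound.  Over a limit point take a hull point at depth s e^-l.  Tightness
   puts a boundary point w of the hull within distance l of it, so the depth of w is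
   between s e^-2l and s up to constants.  In the Klein model the hull is an ordinary
   convex hull, so it has an almost supporting half-space at w; the cap cut out by
   this half-space contains a spherical ball of radius about s e^-2l that is free of
   limit points and within s of the given one.  The limit set is thus porous, and the
   n-dimensional dyadic cubes of size 2^-k that meet it (on the faces of a cube
   projected centrally to the sphere) are at most K (2^n (1 - q))^k in number, with
   q of the order of e^-2nl. *)

Require Import Defs.
From mathcomp Require Import all_boot all_order all_algebra.
From mathcomp Require Import all_classical all_reals all_analysis.
From mathcomp Require Import measurable_realfun.
From mathcomp Require Import zify ring lra.

Import Order.TTheory GRing.Theory Num.Theory.
Import numFieldNormedType.Exports.

Local Open Scope classical_set_scope.
Local Open Scope ring_scope.

Set Implicit Arguments.
Unset Strict Implicit.
Unset Printing Implicit Defensive.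

(** * Euclidean norm *)

(** Distances, geodesics and convexity are handled on the hyperboloid, where [cosh] of the distance
    is a bilinear form and geodesics and half-spaces become linear. The obstacle is that [hull] is
    only the smallest set stable along geodesic lines, while a supporting half-space at [w] needs a
    lower bound for the hull: a Klein point that no half-space separates from the limit set, with a
    margin, must be shown to lie in it. Ideal points are not points of the ball, so finite convex
    combinations of them are regrouped into combinations of chord points. Allowing the half-space an
    error d makes compactness of the set of unit directions sufficient. The error is affordable
    because Klein depth is comparable with the square of the depth b of [w], so that d = b^2 / 4
    still leaves room for a hole of radius b / 2. The exponent 2nl arises because the distance l is
    paid for twice: [w] may be e^l times farther from the limit point than the hull point one starts
    from, and its depth may be e^l times smaller. Each costs a factor e^-l in the relative radius of
    the hole, and the measure of the hole is the n-th power of that. *)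

Section EuclideanNorm.
Context {R : realType} {m : nat}.
Implicit Types (x y z : 'rV[R]_m) (a : R).

Lemma dotrC x y : dotr x y = dotr y x.
Proof. by apply: eq_bigr => i _; rewrite mulrC. Qed.

Lemma dotrDl x y z : dotr (x + y) z = dotr x z + dotr y z.
Proof. by rewrite /dotr -big_split; apply: eq_bigr => i _; rewrite mxE mulrDl. Qed.

Lemma dotrZl a x y : dotr (a *: x) y = a * dotr x y.
Proof. by rewrite /dotr mulr_sumr; apply: eq_bigr => i _; rewrite mxE mulrA. Qed.

Lemma dotrNl x y : dotr (- x) y = - dotr x y.
Proof. by rewrite -scaleN1r dotrZl mulN1r. Qed.

Lemma dotrDr x y z : dotr z (x + y) = dotr z x + dotr z y.
Proof. by rewrite dotrC dotrDl !(dotrC z). Qed.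

Lemma dotrZr a x y : dotr x (a *: y) = a * dotr x y.
Proof. by rewrite dotrC dotrZl dotrC. Qed.

Lemma dotrNr x y : dotr x (- y) = - dotr x y.
Proof. by rewrite dotrC dotrNl dotrC. Qed.

Definition dotrE := (dotrDl, dotrDr, dotrNl, dotrNr, dotrZl, dotrZr).

Lemma dotr_ge0 x : 0 <= dotr x x.
Proof. by apply: sumr_ge0 => i _; rewrite -expr2 sqr_ge0. Qed.

Lemma dotr_eq0 x : dotr x x = 0 -> x = 0.
Proof.
move=> /eqP; rewrite psumr_eq0; last by move=> i _; rewrite -expr2 sqr_ge0.
move=> /allP x0; apply/rowP => i; rewrite mxE; apply/eqP.
by have := x0 i (mem_index_enum i); rewrite /= mulf_eq0 orbb.
Qed.

Lemma dotr0l x : dotr 0 x = 0.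
Proof. by rewrite -(scale0r 0) dotrZl mul0r. Qed.

Lemma dotr_sqr_le x y : dotr x y ^+ 2 <= dotr x x * dotr y y.
Proof.
have [/eqP /dotr_eq0 ->|y0] := boolP (dotr y y == 0).
  by rewrite dotrC !dotr0l mulr0 expr0n.
have yy : 0 < dotr y y by rewrite lt_neqAle eq_sym y0 dotr_ge0.
have := dotr_ge0 (dotr y y *: x - dotr x y *: y).
rewrite !dotrE (dotrC y x) => h.
have : 0 <= dotr y y * (dotr x x * dotr y y - dotr x y ^+ 2) by lra.
by rewrite pmulr_rge0// subr_ge0.
Qed.

Definition enorm x : R := Num.sqrt (dotr x x).

Lemma enorm_ge0 x : 0 <= enorm x. Proof. exact: sqrtr_ge0. Qed.

Lemma sqr_enorm x : enorm x ^+ 2 = dotr x x.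
Proof. by rewrite sqr_sqrtr// dotr_ge0. Qed.

Lemma dotr_enorm_le x y : dotr x y <= enorm x * enorm y.
Proof.
apply: le_trans (ler_norm _) _.
rewrite -ler_sqr ?nnegrE ?mulr_ge0 ?enorm_ge0//.
by rewrite real_normK ?num_real// exprMn !sqr_enorm dotr_sqr_le.
Qed.

Lemma enormN x : enorm (- x) = enorm x.
Proof. by rewrite /enorm dotrNl dotrNr opprK. Qed.

Lemma enormB x y : enorm (x - y) = enorm (y - x).
Proof. by rewrite -enormN opprB. Qed.

Lemma dotr_enorm_ge x y : - (enorm x * enorm y) <= dotr x y.
Proof. by rewrite lerNl -dotrNl -(enormN x) dotr_enorm_le. Qed.

Lemma enormZ a x : enorm (a *: x) = `|a| * enorm x.
Proof. by rewrite /enorm !dotrE mulrA -expr2 sqrtrM ?sqr_ge0// sqrtr_sqr. Qed.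

Lemma enormD x y : enorm (x + y) <= enorm x + enorm y.
Proof.
rewrite -ler_sqr ?nnegrE ?addr_ge0 ?enorm_ge0//.
rewrite sqr_enorm !dotrE (dotrC y x) -!sqr_enorm.
have := dotr_enorm_le x y; nra.
Qed.

Lemma enorm_dist x y z : enorm (x - z) <= enorm (x - y) + enorm (y - z).
Proof. by apply: le_trans (enormD _ _); rewrite addrA subrK. Qed.

Lemma enorm_le_dist x y : enorm x <= enorm y + enorm (x - y).
Proof. by apply: le_trans (enormD _ _); rewrite addrC subrK. Qed.

Lemma enorm_lt1 x : (enorm x < 1) = (dotr x x < 1).
Proof. by rewrite -sqr_enorm expr_lt1// enorm_ge0. Qed.

Lemma enorm1 x : (enorm x = 1) <-> (dotr x x = 1).
Proof.
split=> [|h]; first by rewrite -sqr_enorm => ->; rewrite expr1n.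
by rewrite /enorm h sqrtr1.
Qed.

Lemma enorm_eq0 x : enorm x = 0 -> x = 0.
Proof. by move=> h; apply: dotr_eq0; rewrite -sqr_enorm h expr0n. Qed.

Lemma enorm_gt0 x : x != 0 -> 0 < enorm x.
Proof.
by rewrite lt_def enorm_ge0 andbT; apply: contra_neq; exact: enorm_eq0.
Qed.

Lemma coord_le_enorm x i : `|x 0 i| <= enorm x.
Proof.
rewrite -ler_sqr ?nnegrE ?enorm_ge0// sqr_enorm real_normK ?num_real//.
rewrite /dotr (bigD1 i)//= -expr2 lerDl.
by apply: sumr_ge0 => j _; rewrite -expr2 sqr_ge0.
Qed.

Lemma enorm_le_sup x a : 0 <= a -> (forall i, `|x 0 i| <= a) -> enorm x <= m%:R * a.
Proof.
move=> a0 xa; rewrite -ler_sqr ?nnegrE ?enorm_ge0 ?mulr_ge0// sqr_enorm.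
apply: (@le_trans _ _ (m%:R * a ^+ 2)).
  rewrite -[X in X%:R]card_ord -sumr_const mulr_suml; apply: ler_sum => i _.
  by rewrite mul1r -expr2 -(real_normK (num_real _)) ler_sqr ?nnegrE.
rewrite exprMn ler_wpM2r ?sqr_ge0// expr2.
by case: (m) => [|k]; rewrite ?mulr0// ler_peMr ?ler0n// ler1n.
Qed.

Lemma dotr_continuous y : continuous (fun x => dotr x y).
Proof.
apply: continuous_big => [|i _ x]; first exact: add_continuous.
by apply: continuousM; [exact: (@coord_continuous R 1 m 0 i x) | exact: cst_continuous].
Qed.

Lemma dotrr_continuous : continuous (fun x => dotr x x).
Proof.
apply: continuous_big => [|i _ x]; first exact: add_continuous.
by apply: continuousM; exact: (@coord_continuous R 1 m 0 i x).
Qed.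

End EuclideanNorm.

(** * Hyperboloid model and half-spaces *)

Section Hyperboloid.
Context {R : realType}.

Definition ch (t : R) : R := (expR t + expR (- t)) / 2.

Lemma ch_arcosh (t : R) : 1 <= t -> ch (arcosh t) = t.
Proof.
move=> t1; rewrite /ch /arcosh; set s := Num.sqrt _.
have ss : s ^+ 2 = t ^+ 2 - 1 by rewrite sqr_sqrtr// subr_ge0 expr_ge1//; lra.
have s0 : 0 <= s by exact: sqrtr_ge0.
rewrite expRN lnK ?posrE; last lra.
by field: ss; lra.
Qed.

Lemma arcosh_ch (t : R) : arcosh (ch t) = `|t|.
Proof.
wlog t0 : t / 0 <= t => [h|].
  have [t0|t0] := leP 0 t; first exact: h.
  rewrite -normrN -h; last lra.
  by rewrite /ch opprK addrC.
rewrite ger0_norm// /arcosh.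
have e1 : 1 <= expR t by rewrite -expR0 ler_expR.
have -> : ch t ^+ 2 - 1 = ((expR t - expR (- t)) / 2) ^+ 2.
  by rewrite /ch expRN; field; lra.
rewrite sqrtr_sqr ger0_norm /ch; last first.
  by rewrite divr_ge0// subr_ge0 ler_expR; lra.
by rewrite -[RHS]expRK; congr ln; field.
Qed.

Lemma arcosh_lt (t r : R) : 1 <= t -> 0 <= r -> t < ch r -> arcosh t < r.
Proof.
move=> t1 r0 tr.
have := ch_arcosh t1; set d := arcosh t => dE.
have d0 : 0 <= d by rewrite /d /arcosh ln_ge0//; have := sqrtr_ge0 (t ^+ 2 - 1); lra.
rewrite ltNge; apply/negP => rd; move: tr; rewrite -dE ltNge => /negP; apply.
rewrite /ch !expRN.
have e1 : 1 <= expR r by rewrite -expR0 ler_expR.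
have ee : expR r <= expR d by rewrite ler_expR.
rewrite ler_pM2r// -subr_ge0.
have -> : expR d + (expR d)^-1 - (expR r + (expR r)^-1) =
  (expR d - expR r) * (1 - (expR d)^-1 * (expR r)^-1) by field; lra.
by rewrite mulr_ge0 ?subr_ge0// -invfM invf_le1 ?mulr_gt0//; nra.
Qed.

Context {m : nat}.
Implicit Types (x y z u v : 'rV[R]_m).

Definition htime x : R := (1 + dotr x x) / (1 - dotr x x).

(** [(htime x, hspace x)] is the point of the hyperboloid over [x]. The lock keeps [hspace x] an
    opaque vector during conversion. *)
Definition hspace : 'rV[R]_m -> 'rV[R]_m :=
  locked (fun x => (2 / (1 - dotr x x)) *: x).

Lemma hspaceE x : hspace x = (2 / (1 - dotr x x)) *: x.
Proof. by rewrite /hspace -lock. Qed.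

Lemma minkowski_time_space x : uball x -> htime x ^+ 2 - dotr (hspace x) (hspace x) = 1.
Proof. by rewrite /uball/= => bx; rewrite hspaceE !dotrE /htime; field; lra. Qed.

Lemma htime_ge1 x : uball x -> 1 <= htime x.
Proof.
rewrite /uball/= => bx; rewrite /htime ler_pdivlMr; last lra.
have := dotr_ge0 x; lra.
Qed.

(** The right-hand side is the Minkowski product of the two hyperboloid points. *)
Lemma cosh_hdistE x y : uball x -> uball y ->
  1 + 2 * dotr (x - y) (x - y) / ((1 - dotr x x) * (1 - dotr y y)) =
  htime x * htime y - dotr (hspace x) (hspace y).
Proof.
rewrite /uball/= => bx by_; rewrite !hspaceE !dotrE /htime (dotrC y x); field.
by apply/andP; split; lra.
Qed.

Lemma ch_hdist x y : uball x -> uball y ->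
  ch (hdist x y) = 1 + 2 * dotr (x - y) (x - y) / ((1 - dotr x x) * (1 - dotr y y)).
Proof.
rewrite /uball/= => bx by_; rewrite ch_arcosh// lerDl divr_ge0 ?mulr_ge0 ?dotr_ge0//; lra.
Qed.

(** Cauchy-Schwarz gives [a ^+ 2 * b ^+ 2 <= dotr x x * b ^+ 2], which forces [b = 0]. In Minkowski
    terms, a null vector orthogonal to a timelike one vanishes. *)
Lemma null_orthogonal_timelike (a b : R) x y :
  dotr x x < a ^+ 2 -> dotr y y = b ^+ 2 -> a * b = dotr x y -> b = 0 /\ y = 0.
Proof.
move=> xa yb ab; have := dotr_sqr_le x y; rewrite -ab yb exprMn => h.
have b0 : b = 0.
  apply/eqP/negPn/negP => b0; move: h; rewrite ler_pM2r; first by rewrite leNgt xa.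
  by rewrite lt_neqAle eq_sym sqrf_eq0 b0 sqr_ge0.
by split=> //; apply: dotr_eq0; rewrite yb b0 expr0n.
Qed.

(** Only the distances along [g] are known, but they give the Minkowski products of the three
    hyperboloid points. The expected linear relation is then a null vector orthogonal to the
    timelike point over [g r], hence zero. *)
Lemma geodesic_line_between (g : R -> 'rV[R]_m) (r s t : R) :
  geodesic_line g -> r < s -> s < t ->
  exists a b c : R, [/\ 0 < a, 0 < b, 0 < c,
    c * htime (g s) = a * htime (g r) + b * htime (g t) &
    c *: hspace (g s) = a *: hspace (g r) + b *: hspace (g t)].
Proof.
move=> [gb gd] rs st.
have mE p q : htime (g p) * htime (g q) - dotr (hspace (g p)) (hspace (g q)) = ch (p - q).
  rewrite -cosh_hdistE// -ch_hdist// gd /ch.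
  by case: (ger0P (p - q)) => // _; rewrite opprK addrC.
set P := expR (s - r); set Q := expR (t - s).
have P1 : 1 < P by rewrite expR_gt1 subr_gt0.
have Q1 : 1 < Q by rewrite expR_gt1 subr_gt0.
have ePQ : expR (t - r) = P * Q by rewrite -expRD; congr expR; ring.
have eP' : expR (r - s) = P^-1 by rewrite -expRN opprB.
have eQ' : expR (s - t) = Q^-1 by rewrite -expRN opprB.
have ePQ' : expR (r - t) = (P * Q)^-1 by rewrite -ePQ -expRN opprB.
have := mE r s; have := mE s t; have := mE r t.
rewrite /ch !opprB eP' eQ' ePQ ePQ' -/P -/Q => mrt mst mrs.
(* The coefficients are [sinh (t - s)], [sinh (s - r)] and [sinh (t - r)]. *)
pose a := (Q - Q^-1) / 2; pose b := (P - P^-1) / 2; pose c := (P * Q - (P * Q)^-1) / 2.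
have sinh_gt0 (x : R) : 1 < x -> 0 < (x - x^-1) / 2.
  by move=> x1; rewrite divr_gt0// subr_gt0 (lt_trans _ x1)// invf_lt1//; lra.
have [c0 Y0] : c * htime (g s) - a * htime (g r) - b * htime (g t) = 0 /\
    c *: hspace (g s) - a *: hspace (g r) - b *: hspace (g t) = 0.
  have nr := minkowski_time_space (gb r); have ns := minkowski_time_space (gb s).
  have nt := minkowski_time_space (gb t).
  apply: (@null_orthogonal_timelike (htime (g r)) _ (hspace (g r))).
  - by rewrite -subr_gt0 nr.
  - rewrite !dotrE (dotrC (hspace (g s)) (hspace (g r))) (dotrC (hspace (g t)) (hspace (g r))).
    rewrite (dotrC (hspace (g t)) (hspace (g s))).
    have -> : dotr (hspace (g r)) (hspace (g r)) = htime (g r) ^+ 2 - 1 by lra.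
    have -> : dotr (hspace (g s)) (hspace (g s)) = htime (g s) ^+ 2 - 1 by lra.
    have -> : dotr (hspace (g t)) (hspace (g t)) = htime (g t) ^+ 2 - 1 by lra.
    have -> : dotr (hspace (g r)) (hspace (g s)) = htime (g r) * htime (g s) -
      (P^-1 + P) / 2 by lra.
    have -> : dotr (hspace (g s)) (hspace (g t)) = htime (g s) * htime (g t) -
      (Q^-1 + Q) / 2 by lra.
    have -> : dotr (hspace (g r)) (hspace (g t)) = htime (g r) * htime (g t) -
      ((P * Q)^-1 + P * Q) / 2 by lra.
    by rewrite /a /b /c; field; apply/andP; split; lra.
  - rewrite !dotrE.
    have -> : dotr (hspace (g r)) (hspace (g r)) = htime (g r) ^+ 2 - 1 by lra.
    have -> : dotr (hspace (g r)) (hspace (g s)) = htime (g r) * htime (g s) -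
      (P^-1 + P) / 2 by lra.
    have -> : dotr (hspace (g r)) (hspace (g t)) = htime (g r) * htime (g t) -
      ((P * Q)^-1 + P * Q) / 2 by lra.
    by rewrite /a /b /c; field; apply/andP; split; lra.
exists a, b, c; split; rewrite ?sinh_gt0//; first by nra.
  by lra.
by apply/eqP; rewrite -subr_eq0 opprD addrA Y0.
Qed.

(** The Klein half-space where [2 x / (1 + |x|^2)] has scalar product with [u] below [tau], cleared
    of its denominator. *)
Definition half_space u (tau : R) : set 'rV[R]_m :=
  [set x | uball x /\ 2 * dotr x u < tau * (1 + dotr x x)].

Lemma half_spaceE u (tau : R) x : uball x ->
  (2 * dotr x u < tau * (1 + dotr x x)) = (0 < tau * htime x - dotr (hspace x) u).
Proof.
rewrite /uball/= => bx; rewrite -subr_gt0 /htime hspaceE dotrZl.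
have d0 : 0 < 1 - dotr x x by lra.
rewrite -[RHS](pmulr_rgt0 _ d0); congr (0 < _); field; lra.
Qed.

(** On the hyperboloid the condition is linear and homogeneous, so it passes to positive
    combinations. *)
Lemma half_space_hconvex u (tau : R) : hconvex (half_space u tau).
Proof.
split=> [x []//|g gg]; apply/is_intervalPlt => r t /= [br hr] [bt ht] s /andP[rs st].
have bs : uball (g s) by have [gb _] := gg.
split=> //; rewrite half_spaceE//.
rewrite half_spaceE// in hr; rewrite half_spaceE// in ht.
have [a [b [c [a0 b0 c0 tE sE]]]] := geodesic_line_between gg rs st.
rewrite -(pmulr_rgt0 _ c0) mulrBr -dotrZl sE dotrDl !dotrZl.
have -> : c * (tau * htime (g s)) = tau * (c * htime (g s)) by ring.
by rewrite tE; nra.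
Qed.

(** The defining inequality is open and makes sense on the sphere, where it reads [dotr xi u < tau].
    Both far ends of a geodesic with ends in [L] therefore lie in the half-space, and convexity
    gives the rest. *)
Lemma hull_half_space (L : set 'rV[R]_m) u (tau : R) :
  L `<=` usphere -> (forall xi, L xi -> dotr xi u < tau) ->
  hull L `<=` half_space u tau.
Proof.
move=> LS Lu; apply: smallest_sub; first exact: half_space_hconvex.
move=> _ [g [xi [eta [gg [Lxi Leta] gxi geta [s _ <-]]]]].
have [gb _] := gg.
have ev (F : set_system R) (FF : ProperFilter F) xi' : L xi' -> g t @[t --> F] --> xi' ->
    \forall t \near F, half_space u tau (g t).
  move=> Lx' gx'.
  have h : tau * (1 + dotr (g t) (g t)) - 2 * dotr (g t) u @[t --> F] -->
      tau * (1 + dotr xi' xi') - 2 * dotr xi' u.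
    apply: cvgB; apply: cvgM; try exact: cvg_cst.
      apply: cvgD; first exact: cvg_cst.
      exact: (cvg_comp g (fun x => dotr x x) gx' (@dotrr_continuous R m xi')).
    exact: (cvg_comp g (fun x => dotr x u) gx' (@dotr_continuous R m u xi')).
  have {}h : \forall t \near F, 0 < tau * (1 + dotr (g t) (g t)) - 2 * dotr (g t) u.
    by apply: cvgr_gt h _ _; rewrite (LS _ Lx') subr_gt0; have := Lu _ Lx'; lra.
  by apply: filterS h => t; rewrite subr_gt0 => ht; split.
have [_ hc] := half_space_hconvex u tau.
have [p [ps hp]] : exists p, p <= s /\ half_space u tau (g p).
  near -oo_R => p; exists p; split; last by near: p; exact: (ev _ _ _ Lxi).
  by near: p; apply: nbhs_ninfty_le; rewrite num_real.
have [q [sq hq]] : exists q, s <= q /\ half_space u tau (g q).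
  near +oo_R => q; exists q; split; last by near: q; exact: (ev _ _ _ Leta).
  by near: q; apply: nbhs_pinfty_ge; rewrite num_real.
by apply: (hc g gg p q hp hq s); rewrite ps sq.
Unshelve. all: by end_near. Qed.

(** Otherwise the open half-space whose level [tau] is the Klein value of [y] contains [L], hence
    the hull, hence [y] itself. *)
Lemma hull_supported (L : set 'rV[R]_m) y u : L `<=` usphere -> hull L y ->
  exists2 xi, L xi & 2 * dotr y u <= dotr xi u * (1 + dotr y y).
Proof.
move=> LS Ly; apply: contrapT => h.
pose tau := 2 * dotr y u / (1 + dotr y y).
have y1 : 0 < 1 + dotr y y by have := dotr_ge0 y; lra.
have Lu xi : L xi -> dotr xi u < tau.
  move=> Lxi; rewrite ltr_pdivlMr// ltNge; apply/negP => h'; apply: h; exists xi => //.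
have [_] := hull_half_space LS Lu Ly.
by rewrite /tau mulfVK ?ltxx// gt_eqF.
Qed.

Lemma hull_uball (L : set 'rV[R]_m) : hull L `<=` uball.
Proof.
apply: smallest_sub; last by move=> _ [g [xi [eta [[gb _] _ _ _ [s _ <-]]]]].
by split=> // g [gb _] x y _ _ z _; exact: gb.
Qed.

Lemma hull_hconvex (L : set 'rV[R]_m) : hconvex (hull L).
Proof.
split; first exact: hull_uball.
move=> g gg s t hs ht r rst A [hA LA].
by have [_ /(_ g gg s t)] := hA; apply => //; [exact: hs | exact: ht].
Qed.

Lemma geodesics_sub_hull (L : set 'rV[R]_m) : geodesics_with_ends_in L `<=` hull L.
Proof. exact: sub_smallest. Qed.

End Hyperboloid.

(** * Geodesics with given ends and chords of the hull *)

Section Geodesics.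
Context {R : realType} {m : nat}.
Implicit Types (x y z p q : 'rV[R]_m) (A L : set 'rV[R]_m) (a b pt qt zt wt : R).

(** The open future cone of Minkowski space; [lorentz] is the Lorentzian length on it. *)
Definition future zt z := enorm z < zt.

Definition lorentz zt z : R := Num.sqrt (zt ^+ 2 - dotr z z).

(* The point of the ball whose hyperboloid coordinates are proportional to (zt, z). *)
Definition ball_point zt z : 'rV[R]_m := (zt + lorentz zt z)^-1 *: z.

Lemma future_gt0 zt z : future zt z -> 0 < zt.
Proof. by apply: le_lt_trans; exact: enorm_ge0. Qed.

Lemma futureE zt z : 0 < zt -> (future zt z) = (dotr z z < zt ^+ 2) :> Prop.
Proof.
by move=> zt0; rewrite /future -sqr_enorm ltr_pXn2r ?nnegrE ?enorm_ge0// ltW.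
Qed.

Lemma futureD zt z wt w : future zt z -> future wt w -> future (zt + wt) (z + w).
Proof. by move=> fz fw; apply: le_lt_trans (enormD _ _) _; exact: ltrD. Qed.

Lemma lorentz_gt0 zt z : future zt z -> 0 < lorentz zt z.
Proof.
by move=> fz; rewrite sqrtr_gt0 subr_gt0 -futureE//; exact: future_gt0 fz.
Qed.

Lemma sqr_lorentz zt z : future zt z -> lorentz zt z ^+ 2 = zt ^+ 2 - dotr z z.
Proof.
move=> fz; rewrite sqr_sqrtr// ltW// subr_gt0 -futureE//; exact: future_gt0 fz.
Qed.

Lemma lorentzZ a zt z : 0 < a -> lorentz (a * zt) (a *: z) = a * lorentz zt z.
Proof.
move=> a0; rewrite /lorentz !dotrE -[in RHS](gtr0_norm a0) -sqrtr_sqr -sqrtrM ?sqr_ge0//.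
by congr Num.sqrt; ring.
Qed.

Lemma ball_pointZ a zt z : 0 < a -> ball_point (a * zt) (a *: z) = ball_point zt z.
Proof.
move=> a0; rewrite /ball_point lorentzZ// -mulrDr invfM scalerA mulrAC mulVf ?mul1r//.
by rewrite gt_eqF.
Qed.

Lemma dotr_ball_point zt z : future zt z ->
  1 - dotr (ball_point zt z) (ball_point zt z) = 2 * lorentz zt z / (zt + lorentz zt z).
Proof.
move=> fz; have := sqr_lorentz fz; have := lorentz_gt0 fz; have := future_gt0 fz.
rewrite /ball_point !dotrE; set n := lorentz zt z => zt0 n0 nE.
have -> : dotr z z = zt ^+ 2 - n ^+ 2 by lra.
by field; lra.
Qed.

Lemma ball_point_uball zt z : future zt z -> uball (ball_point zt z).
Proof.
move=> fz; rewrite /uball/= -subr_gt0 dotr_ball_point// divr_gt0 ?mulr_gt0 ?addr_gt0//;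
  by [exact: lorentz_gt0 | exact: future_gt0 fz].
Qed.

Lemma time_ball_point zt z : future zt z -> htime (ball_point zt z) = zt / lorentz zt z.
Proof.
move=> fz; rewrite /htime dotr_ball_point//.
have := dotr_ball_point fz; have := lorentz_gt0 fz; have := future_gt0 fz.
set n := lorentz zt z; set d := dotr _ _ => zt0 n0 dE.
have -> : d = 1 - 2 * n / (zt + n) by lra.
by field; lra.
Qed.

Lemma space_ball_point zt z : future zt z ->
  hspace (ball_point zt z) = (lorentz zt z)^-1 *: z.
Proof.
move=> fz; rewrite hspaceE dotr_ball_point//.
have := lorentz_gt0 fz; have := future_gt0 fz; rewrite /ball_point.
set n := lorentz zt z => zt0 n0; rewrite scalerA; congr (_ *: _).
by field; apply/andP; split; lra.
Qed.

Lemma future_time_space x : uball x -> future (htime x) (hspace x).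
Proof.
move=> bx; rewrite futureE; last by have := htime_ge1 bx; lra.
by have := minkowski_time_space bx; lra.
Qed.

Lemma ball_point_time_space x : uball x -> ball_point (htime x) (hspace x) = x.
Proof.
move=> bx; rewrite /ball_point /lorentz minkowski_time_space// sqrtr1.
move: bx; rewrite /uball/= => bx.
by rewrite hspaceE scalerA /htime (_ : _ * _ = 1) ?scale1r//; field; lra.
Qed.

Lemma hdist_ball_point zt z wt w : future zt z -> future wt w ->
  hdist (ball_point zt z) (ball_point wt w) =
  arcosh ((zt * wt - dotr z w) / (lorentz zt z * lorentz wt w)).
Proof.
move=> fz fw; rewrite /hdist cosh_hdistE; try exact: ball_point_uball.
rewrite !time_ball_point// !space_ball_point// !dotrE; congr arcosh.
have := lorentz_gt0 fz; have := lorentz_gt0 fw.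
set n := lorentz zt z; set n' := lorentz wt w => n'0 n0.
by field; apply/andP; split; lra.
Qed.

(** * The geodesic line joining two null directions *)

Section NullPair.
Variables (pt qt : R) (p q : 'rV[R]_m).
Hypotheses (pt0 : 0 < pt) (qt0 : 0 < qt).
Hypotheses (pp : dotr p p = pt ^+ 2) (qq : dotr q q = qt ^+ 2).
Hypothesis (pq : dotr p q < pt * qt).

Lemma null_pair_future a b : 0 < a -> 0 < b ->
  future (a * pt + b * qt) (a *: p + b *: q).
Proof.
move=> a0 b0; rewrite futureE; last by rewrite addr_gt0 ?mulr_gt0.
rewrite !dotrE (dotrC q p) pp qq.
have : 0 < a * b * (pt * qt - dotr p q) by rewrite !mulr_gt0// subr_gt0.
lra.
Qed.

Lemma lorentz_null_pair a b : lorentz (a * pt + b * qt) (a *: p + b *: q) =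
  Num.sqrt (2 * (a * b) * (pt * qt - dotr p q)).
Proof.
by rewrite /lorentz !dotrE (dotrC q p) pp qq; congr Num.sqrt; ring.
Qed.

Definition null_pair_line (t : R) : 'rV[R]_m :=
  ball_point (expR t * pt + expR (- t) * qt) (expR t *: p + expR (- t) *: q).

(** The vectors [expR t *: p + expR (- t) *: q] have constant Lorentzian length, and the Minkowski
    product of those at [s] and [t] is proportional to [ch (s - t)]: the parameter is arc length. *)
Lemma geodesic_null_pair_line : geodesic_line null_pair_line.
Proof.
split=> [t|s t]; first by apply/ball_point_uball/null_pair_future; exact: expR_gt0.
rewrite hdist_ball_point; try by apply: null_pair_future; exact: expR_gt0.
rewrite !lorentz_null_pair -!expRD !subrr !expR0 mulr1.
have k0 : 0 < pt * qt - dotr p q by rewrite subr_gt0.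
rewrite -expr2 sqr_sqrtr; last by rewrite !mulr_ge0// ltW.
rewrite -arcosh_ch; congr arcosh; rewrite /ch opprB !expRD !dotrE (dotrC q p) pp qq !expRN.
have := expR_gt0 s; have := expR_gt0 t => es et.
by field; apply/and3P; split; lra.
Qed.

Lemma ball_point_null_pair a b : 0 < a -> 0 < b ->
  ball_point (a * pt + b * qt) (a *: p + b *: q) = null_pair_line (ln (a / b) / 2).
Proof.
move=> a0 b0; set r := ln (a / b) / 2; have er : expR r ^+ 2 = a / b.
  rewrite -expRM_natr /r divfK// lnK// posrE divr_gt0//.
have h1 : b * expR r * expR r = a by rewrite -mulrA -expr2 er; field; lra.
have h2 : b * expR r * expR (- r) = b by rewrite -mulrA -expRD subrr expR0 mulr1.
rewrite /null_pair_line -[RHS](ball_pointZ _ _ (_ : 0 < b * expR r)); last first.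
  by rewrite mulr_gt0 ?expR_gt0.
by congr ball_point; rewrite ?(mulrDr, scalerDr) ?scalerA ?mulrA h1 h2.
Qed.

(** After scaling by [expR (- t)] the line is a function [f] of [e = expR (- t)] that is continuous
    at [e = 0], with value [pt^-1 *: p] there. *)
Lemma cvg_null_pair_line : null_pair_line t @[t --> +oo] --> pt^-1 *: p.
Proof.
pose n := Num.sqrt (2 * (pt * qt - dotr p q)).
pose f (e : R) := (pt + e ^+ 2 * qt + e * n)^-1 *: (p + e ^+ 2 *: q).
have fE : null_pair_line = f \o (fun t => expR (- t)).
  apply/funext => t; rewrite /f /= /null_pair_line -(ball_pointZ _ _ (expR_gt0 (- t))).
  rewrite mulrDr scalerDr !scalerA !mulrA -expRD addNr expR0 -expr2.
  rewrite /ball_point lorentz_null_pair -[in RHS](scale1r p) -[in RHS](mul1r pt).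
  congr ((_ + _ + _)^-1 *: _); rewrite /n mul1r.
  rewrite -[in RHS](ger0_norm (expR_ge0 (- t))) -sqrtr_sqr -sqrtrM ?sqr_ge0//.
  by congr Num.sqrt; ring.
have e0 : expR (- t) @[t --> +oo] --> (0 : R) by exact: cvgr_expR.
have -> : pt^-1 *: p = (pt + 0 * 0 * qt + 0 * n)^-1 *: (p + (0 * 0) *: q).
  by rewrite !mul0r !addr0 scale0r addr0.
rewrite fE /f; under eq_fun do rewrite /= expr2.
apply: cvgZ; [apply: cvgV; first by rewrite !mul0r !addr0 gt_eqF|]; repeat apply: cvgD;
  try exact: cvg_cst; try (apply: cvgZ; last exact: cvg_cst);
  try (apply: cvgM; last exact: cvg_cst); try (by apply: cvgM); exact: e0.
Qed.

End NullPair.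

Lemma null_pair_lineN pt qt p q t :
  null_pair_line pt qt p q (- t) = null_pair_line qt pt q p t.
Proof. by rewrite /null_pair_line opprK addrC (addrC (_ *: p)). Qed.

Lemma cvg_null_pair_lineNy pt qt p q : 0 < pt -> 0 < qt ->
  dotr p p = pt ^+ 2 -> dotr q q = qt ^+ 2 -> dotr p q < pt * qt ->
  null_pair_line pt qt p q t @[t --> -oo] --> qt^-1 *: q.
Proof.
move=> pt0 qt0 pp qq pq; rewrite cvgNy_compNP.
rewrite (_ : _ \o _ = null_pair_line qt pt q p); last first.
  by apply/funext => t; rewrite /= null_pair_lineN.
by apply: cvg_null_pair_line => //; rewrite dotrC mulrC.
Qed.

Lemma dotr_usphere_lt1 x y : usphere x -> usphere y -> x <> y -> dotr x y < 1.
Proof.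
rewrite /usphere/= => x1 y1 xy; rewrite ltNge; apply/negP => h; apply: xy.
apply/eqP; rewrite -subr_eq0; apply/eqP/dotr_eq0/eqP.
rewrite eq_le dotr_ge0 andbT !dotrE (dotrC y x); lra.
Qed.

Lemma ideal_chord_future x y a b : usphere x -> usphere y -> x <> y ->
  0 < a -> 0 < b -> future (a + b) (a *: x + b *: y).
Proof.
move=> x1 y1 xy a0 b0; rewrite -{1}(mulr1 a) -{1}(mulr1 b).
apply: null_pair_future; rewrite ?x1 ?y1 ?expr1n ?mulr1//.
exact: dotr_usphere_lt1.
Qed.

Lemma lorentz_ideal_chord x y a b : usphere x -> usphere y ->
  lorentz (a + b) (a *: x + b *: y) = Num.sqrt (2 * (a * b) * (1 - dotr x y)).
Proof.
move=> x1 y1; rewrite -{1}(mulr1 a) -{1}(mulr1 b).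
by rewrite lorentz_null_pair ?x1 ?y1 ?expr1n ?mulr1.
Qed.

Lemma ideal_chord_sub_hull L x y a b : L `<=` usphere -> L x -> L y -> x <> y ->
  0 < a -> 0 < b -> hull L (ball_point (a + b) (a *: x + b *: y)).
Proof.
move=> LS Lx Ly xy a0 b0; apply: geodesics_sub_hull.
have h0 : 0 < (a * b) * (1 - dotr x y).
  by rewrite !mulr_gt0// subr_gt0; apply: dotr_usphere_lt1 => //; exact: LS.
have xx : dotr (a *: x) (a *: x) = a ^+ 2 by rewrite !dotrE (LS _ Lx); ring.
have yy : dotr (b *: y) (b *: y) = b ^+ 2 by rewrite !dotrE (LS _ Ly); ring.
have hxy : dotr (a *: x) (b *: y) < a * b by rewrite !dotrE; lra.
(* Absorbing the weights into the null vectors puts the point at parameter 0. *)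
exists (null_pair_line a b (a *: x) (b *: y)), y, x; split => //.
- exact: geodesic_null_pair_line.
- rewrite -[y in _ --> y](scale1r) -(mulVf (lt0r_neq0 b0)) -scalerA.
  exact: cvg_null_pair_lineNy.
- rewrite -[x in _ --> x](scale1r) -(mulVf (lt0r_neq0 a0)) -scalerA.
  exact: cvg_null_pair_line.
- by exists 0; rewrite // /null_pair_line oppr0 expR0 !mul1r !scale1r.
Qed.

Lemma null_future wt w zt z : dotr w w = wt ^+ 2 -> future zt z ->
  0 < wt * zt - dotr w z -> 0 < wt.
Proof.
move=> ww fz h; rewrite ltNge; apply/negP => wt0.
have ew : enorm w = - wt by rewrite /enorm ww sqrtr_sqr ler0_norm.
have := dotr_enorm_ge w z; rewrite ew.
by move: fz; rewrite /future; nra.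
Qed.

(** Convexity is stated along whole geodesic lines, so the line through [x] and [y] has to be built.
    With [X], [Y] their hyperboloid points and [e] the exponential of their distance, its ends are
    the null directions [Y - X / e] and [e X - Y]. *)
Lemma hconvex_segment A x y a b : hconvex A -> A x -> A y -> 0 < a -> 0 < b ->
  A (ball_point (a * htime x + b * htime y) (a *: hspace x + b *: hspace y)).
Proof.
move=> [Ab Ac] Ax Ay a0 b0; have bx := Ab _ Ax; have by_ := Ab _ Ay.
have [<-|/eqP xy] := eqVneq x y.
  rewrite -mulrDl -scalerDl ball_pointZ ?ball_point_time_space//; exact: addr_gt0.
have nx := minkowski_time_space bx; have ny := minkowski_time_space by_.
have c1 : 1 < htime x * htime y - dotr (hspace x) (hspace y).
  rewrite -cosh_hdistE// ltrDl; apply: divr_gt0.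
    rewrite mulr_gt0// lt_neqAle dotr_ge0 andbT eq_sym.
    by apply/negP => /eqP/dotr_eq0/eqP; rewrite subr_eq0 => /eqP.
  by move: bx by_; rewrite /uball/= => ? ?; rewrite mulr_gt0// subr_gt0.
set c := _ - _ in c1.
pose e := c + Num.sqrt (c ^+ 2 - 1).
have s0 : 0 < Num.sqrt (c ^+ 2 - 1) by rewrite sqrtr_gt0; nra.
have se : Num.sqrt (c ^+ 2 - 1) ^+ 2 = c ^+ 2 - 1 by rewrite sqr_sqrtr; nra.
have e1 : 1 < e by rewrite /e; lra.
have ec : c = (e + e^-1) / 2 by rewrite /e; field: se; lra.
have fx := future_time_space bx.
have [nX nY] : dotr (hspace x) (hspace x) = htime x ^+ 2 - 1 /\
    dotr (hspace y) (hspace y) = htime y ^+ 2 - 1 by split; lra.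
have nXY : dotr (hspace x) (hspace y) = htime x * htime y - (e + e^-1) / 2.
  by rewrite -ec /c; lra.
have ei1 : e^-1 < 1 by rewrite invf_lt1//; lra.
have ei0 : 0 < e^-1 by rewrite invr_gt0; lra.
pose pt := htime y - e^-1 * htime x; pose p := hspace y - e^-1 *: hspace x.
pose qt := e * htime x - htime y; pose q := e *: hspace x - hspace y.
have pp : dotr p p = pt ^+ 2.
  by rewrite /p /pt !dotrE (dotrC (hspace y) (hspace x)) nX nY nXY; field; lra.
have qq : dotr q q = qt ^+ 2.
  by rewrite /q /qt !dotrE (dotrC (hspace y) (hspace x)) nX nY nXY; field; lra.
have pt0 : 0 < pt.
  apply: (null_future pp fx).
  by rewrite /p /pt !dotrE (dotrC (hspace y) (hspace x)) nX nXY; lra.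
have qt0 : 0 < qt.
  apply: (null_future qq fx).
  by rewrite /q /qt !dotrE (dotrC (hspace y) (hspace x)) nX nXY; lra.
have pq : dotr p q < pt * qt.
  rewrite -subr_gt0 [ltRHS](_ : _ = (e - e^-1) ^+ 2 / 2); last first.
    by rewrite /p /q /pt /qt !dotrE (dotrC (hspace y) (hspace x)) nX nY nXY; field; lra.
  by rewrite divr_gt0// exprn_gt0//; lra.
have d0 : 0 < e - e^-1 by lra.
(* [(e - 1/e) (s X + t Y) = (s + t e) p + (s + t / e) q]; thus [x] sits at parameter 0 and [y] at
   [ln e]. *)
have gE (s t : R) : 0 < s + t * e -> 0 < s + t * e^-1 ->
    ball_point (s * htime x + t * htime y) (s *: hspace x + t *: hspace y) =
    null_pair_line pt qt p q (ln ((s + t * e) / (s + t * e^-1)) / 2).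
  move=> h1 h2; rewrite -ball_point_null_pair// -(ball_pointZ _ _ d0); congr ball_point.
    by rewrite /pt /qt; field; lra.
  rewrite /p /q; move: (hspace x) (hspace y) => X Y; apply/rowP => i; rewrite !mxE.
  by field; lra.
rewrite gE; [|by rewrite addr_gt0 ?mulr_gt0//; lra..].
apply: (Ac _ (geodesic_null_pair_line pt0 qt0 pp qq pq) (ln ((1 + 0 * e) / (1 + 0 * e^-1)) / 2)
   (ln ((0 + 1 * e) / (0 + 1 * e^-1)) / 2)).
- rewrite /= -gE; try lra.
  by rewrite !mul1r !mul0r !addr0 scale1r scale0r addr0 ball_point_time_space.
- rewrite /= -gE; try lra.
  by rewrite !mul1r !mul0r !add0r scale1r scale0r add0r ball_point_time_space.
have abe : 0 < a + b * e^-1 by rewrite addr_gt0 ?mulr_gt0.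
have abe' : 0 < a + b * e by rewrite addr_gt0 ?mulr_gt0//; lra.
have -> : (1 + 0 * e) / (1 + 0 * e^-1) = 1 by rewrite !mul0r addr0 divr1.
have -> : (0 + 1 * e) / (0 + 1 * e^-1) = e * e by rewrite !mul1r !add0r invrK.
have ee : e * e^-1 = 1 by rewrite mulfV//; lra.
have ee0 : 0 < e * e by rewrite mulr_gt0; lra.
rewrite !ler_pM2r// !ler_ln ?posrE ?divr_gt0// ler_pdivlMr// ler_pdivrMr//.
have -> : e * e * (a + b * e^-1) = a * (e * e) + b * e by rewrite mulrDr; field; lra.
have ee1 : 1 <= e * e by nra.
by rewrite mul1r lerD2l ler_pM2l// lerD2r ler_peMr ?(ltW a0)// andbT; lra.
Qed.

(** The cone over [A] inside the future cone. For convex [A] it is closed under addition, which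
    turns hyperbolic combinations into plain sums. *)
Definition in_cone A zt z := future zt z /\ A (ball_point zt z).

Lemma in_coneD A zt z wt w : hconvex A ->
  in_cone A zt z -> in_cone A wt w -> in_cone A (zt + wt) (z + w).
Proof.
move=> Ac [fz Az] [fw Aw]; split; first exact: futureD.
have lz := lorentz_gt0 fz; have lw := lorentz_gt0 fw.
have := hconvex_segment Ac Az Aw lz lw.
rewrite !time_ball_point// !space_ball_point// !scalerA !mulfV ?gt_eqF// !scale1r.
by rewrite !mulrA !(mulrC (lorentz _ _)) !mulfK ?gt_eqF.
Qed.

Lemma in_cone_sum A (I : eqType) (s : seq I) (Ft : I -> R) (F : I -> 'rV[R]_m) :
  hconvex A -> s != [::] -> (forall i, i \in s -> in_cone A (Ft i) (F i)) ->
  in_cone A (\sum_(i <- s) Ft i) (\sum_(i <- s) F i).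
Proof.
move=> Ac; elim: s => // i s IH _ sA.
have [->|s0] := eqVneq s [::]; first by rewrite !big_seq1; apply: sA; rewrite mem_head.
rewrite !big_cons; apply: in_coneD => //; first by apply: sA; rewrite mem_head.
by apply: IH => // j js; apply: sA; rewrite inE js orbT.
Qed.

(* Each term of the combination but the first is paired with an equal share of
   the first one, so that x is a combination of points of chords. *)
Lemma hull_combination L (s : seq 'rV[R]_m) (c : 'rV[R]_m -> R) x :
  L `<=` usphere -> uniq s -> (forall y, y \in s -> L y) ->
  (forall y, y \in s -> 0 <= c y) -> uball x ->
  htime x = \sum_(y <- s) c y -> hspace x = \sum_(y <- s) c y *: y -> hull L x.
Proof.
move=> LS us sL c0 bx tE sE.
have fE (V : nmodType) (F : 'rV[R]_m -> V) : (forall y, c y = 0 -> F y = 0) ->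
    \sum_(y <- s) F y = \sum_(y <- [seq y <- s | 0 < c y]) F y.
  move=> F0; rewrite big_filter big_seq [RHS]big_seq_cond big_mkcond [RHS]big_mkcond/=.
  apply: eq_bigr => y _; have [ys|//] := boolP (y \in s); rewrite /=.
  by have := c0 _ ys; rewrite le_eqVlt => /orP[/eqP c0y|->//]; rewrite -c0y ltxx F0.
rewrite fE// in tE; rewrite fE in sE; last by move=> y ->; rewrite scale0r.
have {us} : uniq [seq y <- s | 0 < c y] by rewrite filter_uniq.
have {c0} : forall y, y \in [seq y <- s | 0 < c y] -> 0 < c y /\ L y.
  by move=> y; rewrite mem_filter => /andP[-> /sL].
case: [seq y <- s | 0 < c y] tE sE => [|y r] tE sE cL.
  by move: tE (htime_ge1 bx); rewrite big_nil => ->; rewrite ler10.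
move=> /= /andP[yr ur].
have [cy Ly] : 0 < c y /\ L y by apply: cL; rewrite mem_head.
(* A single term is a null vector, whereas the hyperboloid point of [x] has Lorentzian length 1. *)
have [r0|r0] := eqVneq r [::].
  have := minkowski_time_space bx; rewrite tE sE r0 !big_seq1 !dotrE (LS _ Ly) => /eqP.
  by rewrite mulr1 expr2 subrr eq_sym oner_eq0.
have N0 : 0 < (size r)%:R :> R by rewrite ltr0n lt0n size_eq0.
pose d := c y / (size r)%:R; have d0 : 0 < d by rewrite divr_gt0.
have dE : \sum_(z <- r) d = c y.
  by rewrite big_const_seq count_predT iter_addr_0 -mulr_natr divfK// gt_eqF.
have [_] : in_cone (hull L) (\sum_(z <- r) (c z + d)) (\sum_(z <- r) (c z *: z + d *: y)).
  apply: in_cone_sum => //; first exact: hull_hconvex.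
  move=> z zr; have [cz Lz] : 0 < c z /\ L z by apply: cL; rewrite inE zr orbT.
  have zy : z <> y by move=> zy; rewrite -zy zr in yr.
  split; last exact: ideal_chord_sub_hull.
  by apply: ideal_chord_future => //; exact: LS.
rewrite !big_split/= dE -scaler_suml dE addrC [X in ball_point _ X]addrC.
by rewrite !big_cons in tE sE; rewrite -tE -sE ball_point_time_space.
Qed.

(** Support in the direction [- y]: if [y] were the only point of [L], this would read
    [|x - y|^2 <= 0], with [x] inside the ball and [y] on the sphere. *)
Lemma hull_two_points L x : L `<=` usphere -> hull L x ->
  exists y z, [/\ L y, L z & y <> z].
Proof.
move=> LS Hx; have bx := hull_uball Hx.
have [y Ly _] := hull_supported 0 LS Hx.
apply: contrapT => h.
have [z Lz] := hull_supported (- y) LS Hx.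
have -> : z = y by apply: contrapT => zy; apply: h; exists z, y.
rewrite !dotrNr (LS _ Ly); have := dotr_ge0 (x - y); rewrite !dotrE (dotrC y x) (LS _ Ly).
move: bx; rewrite /uball/=.
have := dotr_sqr_le x y; rewrite (LS _ Ly) mulr1.
set a := dotr x y; set b := dotr x x => h1 h2 h3 h4.
have : (1 - b) ^+ 2 <= 0 by nra.
by apply/negP; rewrite -ltNge exprn_gt0// subr_gt0.
Qed.

Lemma usphere_far L y z x : L `<=` usphere -> y <> z -> L x ->
  L y -> L z -> exists2 x', L x' & enorm (y - z) / 2 <= enorm (x - x').
Proof.
move=> LS yz Lx Ly Lz; have := enorm_dist y x z; rewrite (enormB y x) => h.
have [h'|h'] := leP (enorm (y - z) / 2) (enorm (x - y)); first by exists y.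
by exists z => //; lra.
Qed.

(** The point is taken on the chord from [x] to a point of [L] at distance at least [D], half the
    distance of two fixed points of [L]; this makes [h0] uniform in [x]. *)
Lemma hull_approach L : L `<=` usphere -> hull L !=set0 ->
  exists2 h0 : R, 0 < h0 & forall x (h : R), L x -> 0 < h -> h <= h0 ->
    exists y, [/\ hull L y, enorm (y - x) <= 3 * h &
      h / 3 <= 1 - enorm y <= 2 * h].
Proof.
move=> LS [w Hw]; have [p [q [Lp Lq pq]]] := hull_two_points LS Hw.
pose D := enorm (p - q) / 2.
have D0 : 0 < D by rewrite divr_gt0// enorm_gt0// subr_eq0; apply/eqP.
exists (Num.min 1 (D ^+ 2)); first by rewrite lt_min ltr01 exprn_gt0.
move=> x h Lx h0; rewrite le_min => /andP[h1 hD].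
have [x' Lx' xx'] := usphere_far LS pq Lx Lp Lq.
have dd : dotr (x - x') (x - x') = 2 * (1 - dotr x x').
  by rewrite !dotrE (dotrC x' x) (LS _ Lx) (LS _ Lx'); ring.
have dD : D ^+ 2 <= 2 * (1 - dotr x x').
  by rewrite -dd -sqr_enorm ler_sqr ?nnegrE ?enorm_ge0// ltW.
set k := 2 * _ in dD dd.
have k0 : 0 < k by apply: lt_le_trans dD; rewrite exprn_gt0.
have nx : x <> x'.
  by move=> xx; move: k0; rewrite /k xx (LS _ Lx') subrr mulr0 ltxx.
(* The weights [h^-1] and [b] give the chord point Lorentzian length 1, so its time coordinate is
   [h^-1 + b] and its depth is of order [h]. The choice of [h0] ensures [b <= 1]. *)
pose b := h / k.
have b0 : 0 < b by rewrite divr_gt0.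
have b1 : b <= 1 by rewrite ler_pdivrMr// mul1r (le_trans hD).
have a0 : 0 < h^-1 by rewrite invr_gt0.
have fa : future (h^-1 + b) (h^-1 *: x + b *: x').
  by apply: ideal_chord_future => //; exact: LS.
have la : lorentz (h^-1 + b) (h^-1 *: x + b *: x') = 1.
  rewrite lorentz_ideal_chord; [|exact: LS..].
  rewrite (_ : _ * _ = 1) ?sqrtr1// mulrAC -/k /b.
  by rewrite mulKf ?mulfV ?gt_eqF.
have := dotr_ball_point fa; have := ball_point_uball fa.
have := ideal_chord_sub_hull LS Lx Lx' nx a0 b0.
have := erefl (ball_point (h^-1 + b) (h^-1 *: x + b *: x')).
rewrite {1}/ball_point la; move: (ball_point _ _) => y yE Hy by_ dy {nx pq}.
exists y; split => //.
  rewrite -yE (_ : _ - _ = (h^-1 + b + 1)^-1 *: (b *: x' - (b + 1) *: x)); last first.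
    by move: (h^-1) a0 => g g0; apply/rowP => i; rewrite !mxE; field; lra.
  have x1 : enorm x = 1 by apply/enorm1/LS.
  have x'1 : enorm x' = 1 by apply/enorm1/LS.
  rewrite enormZ ger0_norm ?invr_ge0; last lra.
  apply: (@le_trans _ _ (h * 3)); last lra.
  apply: ler_pM; rewrite ?invr_ge0 ?enorm_ge0//; first lra.
    by rewrite -[leRHS]invrK lef_pV2 ?posrE//; lra.
  apply: le_trans (enormD _ _) _; rewrite enormN !enormZ x1 x'1 !ger0_norm; lra.
move: dy; rewrite mulr1 -sqr_enorm => dy; have := enorm_ge0 y.
have y1 : enorm y < 1 by rewrite enorm_lt1.
have e1 : 2 / (h^-1 + b + 1) <= 2 * h.
  rewrite ler_pM2l// -[leRHS]invrK lef_pV2 ?posrE//; lra.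
have e2 : 2 * (h / 3) <= 2 / (h^-1 + b + 1).
  have hg : h * h^-1 = 1 by rewrite mulfV// gt_eqF.
  rewrite ler_pM2l// -[leRHS]mul1r ler_pdivlMr; last lra.
  have hb : h * b <= 1 by rewrite -[leRHS]mulr1 ler_pM// ltW.
  lra.
by move=> y0; apply/andP; split; nra.
Qed.

End Geodesics.

(** * Almost supporting half-spaces *)

Section SupportingHyperplanes.
Context {R : realType} {m : nat}.
Implicit Types (x y z u v w : 'rV[R]_m) (L : set 'rV[R]_m).

Lemma closed_coord_le (N : nat) (i : 'I_N) (a : R) :
  closed [set c : 'rV[R]_N | a <= c 0 i].
Proof.
by apply: (@preimage_closed _ _ (fun c : 'rV[R]_N => c 0 i) [set t | a <= t]) => // c _;
  exact: (@coord_continuous R 1 N 0 i c).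
Qed.

Lemma compact_unit_box (N : nat) :
  compact [set c : 'rV[R]_N | forall i, `[-1, 1]%classic (c ord0 i)].
Proof.
by apply: (@rV_compact R N (fun=> `[-1, 1]%classic)) => i; exact: segment_compact.
Qed.

Lemma compact_usphere : compact (@usphere R m).
Proof.
apply: subclosed_compact (@compact_unit_box m) _.
  apply: (@preimage_closed _ _ (fun x => dotr x x) [set t | t = 1]).
    by move=> x _; exact: dotrr_continuous.
  exact: closed_eq.
move=> x /enorm1 x1 i /=; rewrite in_itv/= -ler_norml -x1.
exact: coord_le_enorm.
Qed.

(** Minimise the distance to [k] over the simplex of coefficients. If the minimum [y] is not [k],
    the hypothesis in the direction [k - y] yields a vertex [z] towards which the distance
    decreases. *)
Lemma exists_convex_combination (s : seq 'rV[R]_m) (k : 'rV[R]_m) : uniq s -> s != [::] ->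
  (forall u, dotr u u = 1 -> exists2 y, y \in s & 0 < dotr u (y - k)) ->
  exists c : 'rV[R]_m -> R, [/\ forall y, y \in s -> 0 <= c y,
    \sum_(y <- s) c y = 1 & \sum_(y <- s) c y *: y = k].
Proof.
move=> us s0 hs; case sE : (size s) => [|N]; first by case: (s) sE s0.
pose F (c : 'rV[R]_N.+1) : 'rV[R]_m := \sum_(i < N.+1) c 0 i *: s`_i.
have sumE (V : nmodType) (G : 'rV[R]_m -> 'I_N.+1 -> V) :
    \sum_(y <- s) G y (inord (index y s)) = \sum_(i < N.+1) G s`_i i.
  rewrite (big_nth 0) sE big_mkord; apply: eq_bigr => i _.
  by rewrite index_uniq ?sE// inord_val.
pose D := [set c : 'rV[R]_N.+1 | (forall i, 0 <= c 0 i) /\ \sum_i c 0 i = 1].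
have cD : compact D.
  apply: subclosed_compact (@compact_unit_box N.+1) _.
    rewrite (_ : D = (\bigcap_(i in [set: 'I_N.+1]) [set c : 'rV[R]_N.+1 | 0 <= c 0 i]) `&`
        (fun c : 'rV[R]_N.+1 => \sum_i c 0 i) @^-1` [set t | t = 1]); last first.
      by apply/seteqP; split => c /= [h1 h2]; split => // i; [move=> _|]; exact: h1.
    apply: closedI; first by apply: closed_bigI => i _; exact: closed_coord_le.
    apply: preimage_closed; last exact: closed_eq.
    move=> c _; apply: continuous_big => [|i _]; first exact: add_continuous.
    exact: (@coord_continuous R 1 N.+1 0 i).
  move=> c [c0 c1] i /=; rewrite in_itv/=; apply/andP; split.
    by rewrite (le_trans _ (c0 i))// lerN10.
  rewrite -c1 (bigD1 i)//= lerDl; apply: sumr_ge0 => j _; exact: c0.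
have cF : continuous F.
  apply: continuous_big => [|i _ c]; first exact: add_continuous.
  exact: (cvgZr_tmp (@coord_continuous R 1 N.+1 0 i c)).
have D0 : D !=set0.
  exists (delta_mx 0 ord0); split=> [i|]; first by rewrite mxE ler0n.
  rewrite (bigD1 ord0)//= mxE !eqxx big1 ?addr0// => i i0.
  by rewrite mxE eqxx (negPf i0).
have [c cD' cmin] : exists2 c, c \in D & forall c', c' \in D ->
    dotr (F c - k) (F c - k) <= dotr (F c' - k) (F c' - k).
  apply: EVT_min_rV D0 cD _; apply: continuous_subspaceT => c.
  apply: (@continuous_comp _ _ _ (fun c => F c - k) (fun x => dotr x x)).
    by apply: continuousB; [exact: cF | exact: cst_continuous].
  exact: dotrr_continuous.
move: cD'; rewrite inE => -[c0 c1].
suff Fk : F c = k.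
  exists (fun y => c 0 (inord (index y s))); split => //.
    by rewrite (sumE _ (fun _ i => c 0 i)).
  by rewrite (sumE _ (fun y i => c 0 i *: y)).
apply: contrapT => Fk; set y := F c in cmin Fk.
have e0 : 0 < enorm (k - y).
  by apply: enorm_gt0; rewrite subr_eq0; apply/eqP => ky; apply: Fk.
have {Fk} [|z zs] := hs ((enorm (k - y))^-1 *: (k - y)).
  by rewrite dotrZl dotrZr -sqr_enorm expr2 mulKf ?mulVf ?gt_eqF.
rewrite dotrZl pmulr_rgt0 ?invr_gt0// => hz.
pose j : 'I_N.+1 := inord (index z s).
have jz : s`_j = z by rewrite /j inordK ?nth_index// -sE index_mem.
clear sE; pose g := dotr (k - y) (z - y); pose h := dotr (z - y) (z - y).
have g0 : 0 < g.
  rewrite /g -(subrK k z) -addrA dotrDr -sqr_enorm.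
  by rewrite addr_gt0 ?exprn_gt0.
have h0 : 0 <= h by exact: dotr_ge0.
(* Moving by [t] changes the squared distance by [t (t h - 2 g)]; this [t] satisfies both
   [t h < 2 g] and [t <= 1]. *)
pose t := g / (g + h).
have t0 : 0 < t by rewrite divr_gt0//; lra.
have t1 : t <= 1 by rewrite ler_pdivrMr; lra.
have tgh : t * (g + h) = g by rewrite divfK// gt_eqF//; lra.
have Fj : F (delta_mx 0 j) = z.
  rewrite /F (bigD1 j)//= mxE !eqxx scale1r big1 ?addr0// => i ij.
  by rewrite mxE eqxx (negPf ij) scale0r.
have FE : F ((1 - t) *: c + t *: delta_mx 0 j) = (1 - t) *: y + t *: z.
  rewrite -Fj /y /F !scaler_sumr -big_split; apply: eq_bigr => i _.
  by apply/rowP => q; rewrite !mxE; ring.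
have {}D0 : (1 - t) *: c + t *: delta_mx 0 j \in D.
  rewrite inE; split=> [i|].
    by rewrite !mxE addr_ge0// mulr_ge0 ?ler0n ?subr_ge0// ltW.
  under eq_bigr do rewrite !mxE; rewrite big_split -!mulr_sumr c1 (bigD1 j)//= !eqxx.
  by rewrite big1 ?addr0 ?mulr1 ?subrK// => i ij; rewrite (negPf ij).
have := cmin _ D0; rewrite FE; apply/negP; rewrite -ltNge.
have -> : (1 - t) *: y + t *: z - k = t *: (z - y) - (k - y).
  by apply/rowP => i; rewrite !mxE; ring.
rewrite -(opprB k y); move: g0 h0 t0 tgh; rewrite /g /h.
move: t {D0 FE t1} (k - y) (z - y) => t v v'; rewrite !dotrE (dotrC v' v) => g0 h0 t0 tgh.
rewrite -subr_gt0 (_ : _ - _ = t * (2 * dotr v v' - t * dotr v' v')); last ring.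
by apply: mulr_gt0 => //; nra.
Qed.

Definition klein x : 'rV[R]_m := (2 / (1 + dotr x x)) *: x.

Lemma cvg_dotrr (T : Type) (F : set_system T) {FF : Filter F} (f : T -> 'rV[R]_m) x :
  f t @[t --> F] --> x -> dotr (f t) (f t) @[t --> F] --> dotr x x.
Proof. by move=> fx; exact: (cvg_comp f _ fx (@dotrr_continuous R m x)). Qed.

Lemma cvg_klein (T : Type) (F : set_system T) {FF : Filter F} (f : T -> 'rV[R]_m) x :
  f t @[t --> F] --> x -> klein (f t) @[t --> F] --> klein x.
Proof.
move=> fx; have h : 1 + dotr x x != 0 by rewrite gt_eqF//; have := dotr_ge0 x; lra.
apply: cvgZ => //; apply: cvgM; first exact: cvg_cst.
by apply: cvgV => //; apply: cvgD; [exact: cvg_cst | exact: cvg_dotrr].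
Qed.

Lemma near_dotrr_lt (T : Type) (F : set_system T) (FF : Filter F) (f : T -> 'rV[R]_m) x (a : R) :
  f t @[t --> F] --> x -> dotr x x < a -> \forall t \near F, dotr (f t) (f t) < a.
Proof. by move=> fx xa; exact: (cvgr_lt _ (cvg_dotrr fx) _ xa). Qed.

Lemma near_klein_lt (T : Type) (F : set_system T) (FF : Filter F) (f : T -> 'rV[R]_m) x (d : R) :
  f t @[t --> F] --> x -> 0 < d -> \forall t \near F, enorm (klein (f t) - klein x) < d.
Proof.
move=> fx d0; have kx : klein (f t) - klein x @[t --> F] --> klein x - klein x.
  by apply: cvgB; [exact: cvg_klein | exact: cvg_cst].
have kd : dotr (klein x - klein x) (klein x - klein x) < d ^+ 2.
  by rewrite subrr dotr0l exprn_gt0.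
apply: filterS (near_dotrr_lt FF kx kd) => t; rewrite -sqr_enorm.
by rewrite ltr_sqr ?nnegrE ?enorm_ge0 ?ltW.
Qed.

Lemma hspace_klein x : uball x -> hspace x = htime x *: klein x.
Proof.
rewrite /uball/= => bx; rewrite hspaceE /htime /klein scalerA; congr (_ *: _).
have h := dotr_ge0 x; field; apply/andP; split; lra.
Qed.

(** Compactness of the sphere of directions [u] replaces [L] by a finite subset, and the margin [d]
    absorbs the displacement from [k] to [klein x]. Then [klein x] is a convex combination of points
    of [L], and scaling it by [htime x] gives the hyperboloid point. *)
Lemma hull_klein_neighborhood L k (d : R) : L `<=` usphere -> 0 < d -> L !=set0 ->
  (forall u, dotr u u = 1 -> exists2 y, L y & dotr u k + d < dotr u y) ->
  forall x, uball x -> enorm (klein x - k) < d -> hull L x.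
Proof.
move=> LS d0 [y0 Ly0] hk x bx xk.
pose f y : set 'rV[R]_m := [set u | dotr k u + d < dotr y u].
have fo y : L y -> open (f y).
  move=> _; rewrite (_ : f y = (fun u => dotr u y - dotr u k) @^-1` [set t | d < t]).
    apply: open_comp => [u _|]; last exact: open_gt.
    exact: (cvgB (@dotr_continuous R m y u) (@dotr_continuous R m k u)).
  by apply/seteqP; split => u; rewrite /f/= ltrBrDl !(dotrC _ u).
have cs := @compact_usphere; rewrite compact_cover in cs.
have [|D DL Dc] := cs _ L f fo.
  by move=> u u1; have [y Ly h] := hk _ u1; exists y => //; rewrite /f/= !(dotrC _ u).
(* Adding [y0] keeps the list non-empty even when the finite cover is empty. *)
pose s := undup (y0 :: finmap.enum_fset D).
have sL y : y \in s -> L y.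
  by rewrite mem_undup inE => /orP[/eqP ->//|yD]; have := DL _ yD; rewrite inE.
have [|||c [c0 c1 ck]] := @exists_convex_combination s (klein x).
- exact: undup_uniq.
- have : y0 \in s by rewrite mem_undup mem_head.
  by case: (s).
- move=> u u1; have [y yD] := Dc _ u1; rewrite /f/= => hy.
  exists y; first by rewrite mem_undup inE yD orbT.
  have -> : y - klein x = y - k - (klein x - k) by rewrite opprB addrA subrK.
  have := dotr_enorm_le u (klein x - k); rewrite (enorm1 u).2// mul1r.
  by rewrite !(dotrDr, dotrNr) !(dotrC u y) !(dotrC u k); lra.
apply: (@hull_combination _ _ _ s (fun y => htime x * c y)) => //.
- exact: undup_uniq.
- by move=> y ys; rewrite mulr_ge0 ?c0// (le_trans ler01)// htime_ge1.
- by rewrite -mulr_sumr c1 mulr1.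
- rewrite hspace_klein// -ck scaler_sumr; apply: eq_bigr => y _.
  by rewrite scalerA.
Qed.

(** If every direction failed, all points whose Klein image is within [d] of [klein w] would be in
    the hull, and [w] would be interior. *)
Lemma hboundary_support L w (d : R) : L `<=` usphere -> hboundary (hull L) w -> 0 < d ->
  exists2 u, dotr u u = 1 & forall y, L y -> dotr u y <= dotr u (klein w) + d.
Proof.
move=> LS [[cw iw] bw] d0; apply: contrapT => h; apply: iw.
have L0 : L !=set0.
  have [z [Lz _]] := cw _ (@filterT _ _ _).
  by have [y Ly _] := hull_supported 0 LS Lz; exists y.
have hk u : dotr u u = 1 -> exists2 y, L y & dotr u (klein w) + d < dotr u y.
  move=> u1; apply: contrapT => h'; apply: h; exists u => // y Ly.
  by rewrite leNgt; apply/negP => ?; apply: h'; exists y.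
have nb := @near_dotrr_lt _ (nbhs w) (nbhs_filter w) id w 1 (@cvg_id _ _) bw.
have nd := @near_klein_lt _ (nbhs w) (nbhs_filter w) id w d (@cvg_id _ _) d0.
by apply: filterS2 nb nd => x bx xw; exact: (hull_klein_neighborhood LS d0 L0 hk).
Qed.

End SupportingHyperplanes.

(** * Porosity of tight limit sets *)

Section Porosity.
Context {R : realType}.

Lemma dotr_delta n (i : 'I_n) (v : 'rV[R]_n) : dotr (delta_mx 0 i) v = v 0 i.
Proof.
rewrite /dotr (bigD1 i)//= mxE !eqxx mul1r big1 ?addr0// => j ji.
by rewrite mxE eqxx (negPf ji) mul0r.
Qed.

Lemma dotr_normalize n (v : 'rV[R]_n) : v != 0 ->
  dotr ((enorm v)^-1 *: v) ((enorm v)^-1 *: v) = 1.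
Proof.
move=> /enorm_gt0 v0; rewrite dotrZl dotrZr -sqr_enorm expr2.
by rewrite mulKf ?mulVf ?gt_eqF.
Qed.

Lemma sqr_enorm_usphere n (x y : 'rV[R]_n) : dotr x x = 1 -> dotr y y = 1 ->
  enorm (x - y) ^+ 2 = 2 - 2 * dotr x y.
Proof.
move=> x1 y1; rewrite sqr_enorm dotrDl !dotrDr !(dotrNl, dotrNr) (dotrC y x) x1 y1.
ring.
Qed.

Lemma exists_orthogonal n (v : 'rV[R]_n.+1) : (1 <= n)%N ->
  exists2 e, dotr e e = 1 & dotr v e = 0.
Proof.
move=> n1; pose j : 'I_n.+1 := inord 1.
have j0 : (0 == j :> 'I_n.+1) = false by apply/eqP => /(congr1 val); rewrite /= inordK.
have [v0|v0] := eqVneq (v 0 0) 0.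
  by exists (delta_mx 0 0); rewrite 1?dotrC !dotr_delta// mxE !eqxx.
pose e : 'rV[R]_n.+1 := v 0 j *: delta_mx 0 0 - v 0 0 *: delta_mx 0 j.
have ve : dotr v e = 0.
  by rewrite dotrC dotrDl dotrNl !dotrZl !dotr_delta mulrC subrr.
have e0 : e != 0.
  apply/eqP => /rowP/(_ j); rewrite !mxE !eqxx eq_sym j0 mulr0 mulr1 sub0r => /eqP.
  by rewrite oppr_eq0 (negPf v0).
by exists ((enorm e)^-1 *: e); [exact: dotr_normalize | rewrite dotrZr ve mulr0].
Qed.

Context {n : nat}.
Implicit Types (x y u v w : 'rV[R]_n.+1) (L : set 'rV[R]_n.+1).

(** When [u] is [v] or [- v], [s] is 0 and [e] is any unit vector orthogonal to [v], which exists
    since the space has dimension at least 2. *)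
Lemma orthogonal_decomposition u v : (1 <= n)%N -> dotr u u = 1 -> dotr v v = 1 ->
  exists e (s : R), [/\ dotr e e = 1, dotr v e = 0, 0 <= s,
    s ^+ 2 = 1 - dotr u v ^+ 2 & u = dotr u v *: v + s *: e].
Proof.
move=> n1 u1 v1; pose p := u - dotr u v *: v.
have pp : dotr p p = 1 - dotr u v ^+ 2.
  by rewrite /p dotrDl !dotrDr !(dotrNl, dotrNr) !(dotrZl, dotrZr) (dotrC v u) u1 v1; ring.
have [p0|p0] := eqVneq p 0.
  have [e e1 ve] := exists_orthogonal v n1; exists e, 0; split => //.
    by rewrite -pp p0 dotr0l expr0n.
  by rewrite scale0r addr0; apply/eqP; rewrite -subr_eq0 -/p p0.
exists ((enorm p)^-1 *: p), (enorm p); split.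
- exact: dotr_normalize.
- by rewrite dotrZr /p dotrDr dotrNr dotrZr v1 (dotrC v u) mulr1 subrr mulr0.
- exact: enorm_ge0.
- by rewrite sqr_enorm.
- by rewrite scalerA mulfV ?gt_eqF ?enorm_gt0// scale1r /p addrC subrK.
Qed.

(** With [r = enorm w], [1 - 2 r / (1 + r^2) = (1 - r)^2 / (1 + r^2)]. A Klein cap of depth about
    [b ^+ 2] thus has spherical radius of order [b]. *)
Lemma klein_depth w : enorm w < 1 -> w != 0 ->
  exists2 k, klein w = (1 - k) *: ((enorm w)^-1 *: w) &
    (1 - enorm w) ^+ 2 / 2 <= k <= (1 - enorm w) ^+ 2.
Proof.
move=> w1 /enorm_gt0 w0; pose r := enorm w.
exists ((1 - r) ^+ 2 / (1 + r ^+ 2)).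
  rewrite scalerA /klein -sqr_enorm -/r; congr (_ *: _).
  have h := sqr_ge0 r; field; rewrite -/r in w0; apply/andP; split; lra.
have r2 : r ^+ 2 <= 1 by rewrite expr_le1// ltW.
have r0 : 0 <= r ^+ 2 by exact: sqr_ge0.
rewrite -/r; apply/andP; split.
  by rewrite ler_wpM2l ?sqr_ge0// lef_pV2 ?posrE; lra.
by rewrite ler_pdivrMr ?ler_peMr ?sqr_ge0; lra.
Qed.

(** Here [b] and [k] are the depth and Klein depth of [w], [C] and [s] the coordinates of [u] on [v]
    and [e], and [1 - D], [E] those of the point [y] of the hole. If [C <= 0], then [s - C >= 1],
    while [D - k] and [E] are both at least [2 b^2]. If [C > 0], the last hypothesis gives
    [s > 11/2 b], so [s E > 55/4 b^2] outweighs [C D <= 25/2 b^2] plus the margin. *)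
Lemma hole_inequality (b k C s D E : R) : 0 < b -> b <= 3^-1 ->
  0 <= k -> k <= b ^+ 2 -> C <= 1 -> 0 <= s -> s ^+ 2 = 1 - C ^+ 2 ->
  5 / 2 * b < E -> E ^+ 2 / 2 <= D -> 2 * D <= (5 * b) ^+ 2 -> (8 * b) ^+ 2 < 2 - 2 * C ->
  (1 - k) * C + b ^+ 2 / 4 < C * (1 - D) + s * E.
Proof.
move=> b0 b3 k0 k2 C1 s0 s2 E1 D1 D2 hC.
have b2 : 0 < b ^+ 2 by rewrite exprn_gt0.
have bb : b ^+ 2 <= b by rewrite expr2 ler_piMr//; lra.
have EE : (5 / 2 * b) ^+ 2 <= E ^+ 2 by rewrite ler_sqr ?nnegrE//; lra.
have [Cneg|Cpos] := leP C 0.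
  have sC : 0 <= s * - C by rewrite mulr_ge0//; lra.
  have h : 1 <= s - C.
    have : 1 <= (s - C) ^+ 2 by lra.
    by rewrite expr_ge1//; lra.
  have h1 : 0 <= - C * (D - k - 2 * b ^+ 2) by rewrite mulr_ge0; lra.
  have h2 : 0 <= s * (E - 2 * b ^+ 2) by rewrite mulr_ge0; lra.
  have h3 : 0 <= (s - C - 1) * b ^+ 2 by rewrite mulr_ge0; lra.
  lra.
have ss : (11 / 2 * b) ^+ 2 < s ^+ 2.
  have h1 : 0 <= C * (1 - C) by rewrite mulr_ge0; lra.
  rewrite s2; lra.
rewrite ltr_sqr ?nnegrE// in ss; last lra.
have h1 : 0 <= C * (25 / 2 * b ^+ 2 - (D - k)) by rewrite mulr_ge0; lra.
have h2 : 0 <= (1 - C) * b ^+ 2 by rewrite mulr_ge0; lra.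
have h3 : 0 <= (s - 11 / 2 * b) * E by rewrite mulr_ge0; lra.
have h4 : 0 <= b * (E - 5 / 2 * b) by rewrite mulr_ge0; lra.
lra.
Qed.

(* Writing u = C v + s e with v = w / |w|, the centre of the hole is obtained
   from v by a rotation of sine 3 b towards e, or is u itself if u is close to v. *)
Lemma half_space_hole u w : (1 <= n)%N -> dotr u u = 1 -> 2 / 3 <= enorm w < 1 ->
  exists2 x, dotr x x = 1 & enorm (x - w) <= 9 * (1 - enorm w) /\
    forall y, dotr y y = 1 -> enorm (y - x) < (1 - enorm w) / 2 ->
      dotr u (klein w) + (1 - enorm w) ^+ 2 / 4 < dotr u y.
Proof.
move=> n1 u1 /andP[w0 w1]; set b := 1 - enorm w.
have wn0 : w != 0 by apply: contraTneq w0 => ->; rewrite /enorm dotr0l sqrtr0; lra.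
have [k kE /andP[k1 k2]] := klein_depth w1 wn0; rewrite -/b in k1 k2.
pose v := (enorm w)^-1 *: w; have v1 : dotr v v = 1 by exact: dotr_normalize.
have vw : enorm (v - w) = b.
  have -> : v - w = ((enorm w)^-1 - 1) *: w by rewrite scalerBl scale1r.
  rewrite enormZ ger0_norm; last by rewrite subr_ge0 invf_ge1; lra.
  by rewrite mulrBl mul1r mulVf// gt_eqF//; lra.
rewrite -/v in kE; clearbody v; have b0 : 0 < b by rewrite /b; lra.
have b3 : b <= 3^-1 by rewrite /b; lra.
have C1 : dotr u v <= 1.
  have := dotr_enorm_le u v; rewrite (enorm1 u).2// (enorm1 v).2// mulr1//.
have [e [s [e1 ve s0 s2 uE]]] := orthogonal_decomposition n1 u1 v1.
rewrite kE dotrZr.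
have uv2 := sqr_enorm_usphere u1 v1.
have [uv|uv] := leP (enorm (u - v)) (8 * b).
  exists u => //; split=> [|y y1 yu].
    apply: le_trans (enorm_dist _ v _) _; rewrite vw; lra.
  (* On the hole [dotr u y > 1 - b^2 / 8], while the Klein depth of [w] is at least [b^2 / 2]; the
     margin [b^2 / 4] fits in between. *)
  have yu2 := sqr_enorm_usphere y1 u1; rewrite (dotrC y u) in yu2.
  have yb : enorm (y - u) ^+ 2 < (b / 2) ^+ 2.
    by rewrite ltr_sqr ?nnegrE ?enorm_ge0//; lra.
  have b2 : b ^+ 2 <= 1 by rewrite expr_le1//; lra.
  nra.
(* Points within [b / 2] of the rotated centre keep [E > 3 b - b / 2] and stay within
   [9/2 b + b / 2] of [v]. *)
pose t := 3 * b; pose c := Num.sqrt (1 - t ^+ 2).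
have t2 : t ^+ 2 <= 1 by rewrite expr_le1// /t; lra.
have cc : c ^+ 2 = 1 - t ^+ 2 by rewrite sqr_sqrtr; lra.
have c0 : 0 <= c by exact: sqrtr_ge0.
have c1 : 1 - t ^+ 2 <= c by rewrite -cc expr2 ler_piMr//; nra.
pose x := c *: v + t *: e.
have x1 : dotr x x = 1.
  by rewrite /x dotrDl !dotrDr !(dotrZl, dotrZr) (dotrC e v) v1 e1 ve; lra.
have xv : enorm (x - v) <= 3 / 2 * t.
  rewrite -ler_sqr ?nnegrE ?enorm_ge0//; last by rewrite /t; lra.
  rewrite sqr_enorm_usphere//.
  have -> : dotr x v = c by rewrite /x dotrDl !dotrZl v1 (dotrC e v) ve; ring.
  by rewrite exprMn; have := sqr_ge0 t; lra.
exists x => //; split=> [|y y1 yx].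
  apply: le_trans (enorm_dist _ v _) _; rewrite vw; move: xv; rewrite /t; lra.
pose E := dotr e y; pose D := 1 - dotr v y.
have yE : E = t + dotr e (y - x).
  rewrite /E dotrDr dotrNr /x dotrDr !dotrZr (dotrC e v) ve e1; ring.
have E1 : 5 / 2 * b < E.
  have := dotr_enorm_ge e (y - x); rewrite (enorm1 e).2// mul1r yE /t; lra.
have yv2 : enorm (y - v) ^+ 2 = 2 * D.
  by rewrite /D sqr_enorm_usphere// (dotrC y v); ring.
have D1 : E ^+ 2 / 2 <= D.
  have : E ^+ 2 <= enorm (y - v) ^+ 2; last by rewrite yv2; lra.
  have := dotr_sqr_le e (y - v); rewrite e1 mul1r sqr_enorm dotrDr dotrNr (dotrC e v) ve subr0.
  by [].
have D2 : 2 * D <= (5 * b) ^+ 2.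
  rewrite -yv2 ler_sqr ?nnegrE ?enorm_ge0//; last lra.
  apply: le_trans (enorm_dist _ x _) _; move: xv; rewrite /t; lra.
have -> : dotr u y = dotr u v * (1 - D) + s * E.
  by rewrite {1}uE dotrDl !dotrZl /D /E; ring.
apply: hole_inequality => //; first lra.
by rewrite -uv2 ltr_sqr ?nnegrE ?enorm_ge0//; lra.
Qed.

Lemma hdist_ge0 x y : uball x -> uball y -> 0 <= hdist x y.
Proof.
rewrite /uball/= => bx by_; rewrite /hdist /arcosh ln_ge0//.
have h : 0 <= 2 * dotr (x - y) (x - y) / ((1 - dotr x x) * (1 - dotr y y)).
  by rewrite divr_ge0 ?mulr_ge0 ?dotr_ge0//; lra.
have := sqrtr_ge0 ((1 + 2 * dotr (x - y) (x - y) / ((1 - dotr x x) * (1 - dotr y y))) ^+ 2 - 1).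
lra.
Qed.

Lemma ch_le_expR (t : R) : 0 <= t -> ch t <= expR t.
Proof.
move=> t0; rewrite /ch ler_pdivrMr//.
have : expR (- t) <= expR t by rewrite ler_expR; lra.
lra.
Qed.

Lemma hdist_enorm_sqr x y (l : R) : uball x -> uball y -> hdist x y <= l ->
  enorm (x - y) ^+ 2 <= 2 * expR l * ((1 - enorm x) * (1 - enorm y)).
Proof.
move=> bx by_ xl; have d0 := hdist_ge0 bx by_.
have := ch_le_expR d0; rewrite ch_hdist// sqr_enorm => h.
have el : expR (hdist x y) <= expR l by rewrite ler_expR.
have x1 : enorm x < 1 by rewrite enorm_lt1.
have y1 : enorm y < 1 by rewrite enorm_lt1.
have x0 := enorm_ge0 x; have y0 := enorm_ge0 y.
move: h; rewrite -(sqr_enorm x) -(sqr_enorm y).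
set a := 1 - enorm x ^+ 2; set b := 1 - enorm y ^+ 2; set d := dotr _ _ => h.
have a0 : 0 < a by rewrite /a; nra.
have b0 : 0 < b by rewrite /b; nra.
have {}h : 2 * d <= expR l * (a * b).
  by rewrite -ler_pdivrMr ?mulr_gt0//; lra.
have a2 : a <= 2 * (1 - enorm x) by rewrite /a; nra.
have b2 : b <= 2 * (1 - enorm y) by rewrite /b; nra.
have ab : a * b <= 2 * (1 - enorm x) * (2 * (1 - enorm y)) by rewrite ler_pM// ltW.
have : expR l * (a * b) <= expR l * (2 * (1 - enorm x) * (2 * (1 - enorm y))).
  by rewrite ler_wpM2l// expR_ge0.
lra.
Qed.

(** Since [1 - |y| <= 1 - |x| + |x - y|], the bound on the squared distance becomes a quadratic
    inequality in [|x - y|]. *)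
Lemma hdist_enorm x y (l : R) : uball x -> uball y -> 0 <= l -> hdist x y <= l ->
  enorm (x - y) <= 4 * expR l * (1 - enorm x) /\
  1 - enorm y <= 5 * expR l * (1 - enorm x).
Proof.
move=> bx by_ l0 xl; have := hdist_enorm_sqr bx by_ xl.
have x1 : enorm x < 1 by rewrite enorm_lt1.
have E1 : 1 <= expR l by rewrite -expR0 ler_expR.
have := enorm_le_dist x y; have := enorm_ge0 (x - y).
move: E1 x1; set E := expR l; set d := enorm (x - y) => E1 x1 d0 h1 h2.
suff h : d <= 4 * E * (1 - enorm x) by split => //; nra.
rewrite leNgt; apply/negP => h.
have a0 : 0 < 1 - enorm x by lra.
have Ea : 0 < E * (1 - enorm x) by rewrite mulr_gt0//; lra.
have h3 : d ^+ 2 <= 2 * (E * (1 - enorm x)) * (1 - enorm x + d).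
  apply: le_trans h2 _; rewrite -!mulrA ler_pM2l// ler_pM2l; last lra.
  by rewrite ler_pM2l//; lra.
have h4 : 4 * (E * (1 - enorm x)) * d < d ^+ 2 by rewrite expr2 ltr_pM2r; lra.
have h5 : E * (1 - enorm x) * (1 - enorm x) <= E * (1 - enorm x) * (E * (1 - enorm x)).
  by rewrite ler_pM2l// ler_peMl; lra.
have h6 : E * (1 - enorm x) * (4 * (E * (1 - enorm x))) <= E * (1 - enorm x) * d.
  by rewrite ler_pM2l; lra.
have : 0 < E * (1 - enorm x) * (E * (1 - enorm x)) by rewrite mulr_gt0.
lra.
Qed.

Lemma tight_porous L (l : R) : (1 <= n)%N -> 0 <= l -> L `<=` usphere ->
  hull L !=set0 -> tight l L ->
  exists2 s0 : R, 0 < s0 & forall x s, L x -> 0 < s -> s <= s0 ->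
    exists y, [/\ usphere y, enorm (y - x) <= s &
      forall z, L z -> s / (60 * expR l) ^+ 2 <= enorm (z - y)].
Proof.
move=> n1 l0 LS L0 tL; have [h0 h0p hL] := hull_approach LS L0.
exists (Num.min 1 h0); first by rewrite lt_min ltr01.
move=> x s Lx s0; rewrite le_min => /andP[s1 sh].
have E1 : 1 <= expR l by rewrite -expR0 ler_expR.
(* In units of [h * expR l]: the hull point is within 3 of [x], [w] within 4 * 2 of it with depth at
   most 5 * 2, and the centre of the hole within 9 * 10 of [w]. The sum is 101. *)
pose h := s / (101 * expR l).
have hs : h * (101 * expR l) = s by rewrite /h divfK// gt_eqF//; lra.
have h00 : 0 < h by rewrite /h divr_gt0//; lra.
clearbody h; have hh0 : h <= h0 by apply: le_trans sh; rewrite -hs ler_peMr; lra.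
have [y [Hy yx /andP[y1 y2]]] := hL x h Lx h00 hh0.
have by_ := hull_uball Hy.
have [w Bw yw] := tL _ Hy; have [_ bw] := Bw.
have [d1 d2] := hdist_enorm by_ bw l0 yw.
have wy : hdist w y <= l.
  move: yw; rewrite /hdist -(opprB w y) dotrNl dotrNr opprK.
  by rewrite (mulrC (1 - dotr y y)).
have [_ d3] := hdist_enorm bw by_ l0 wy.
have w1 : enorm w < 1 by rewrite enorm_lt1.
have yE : expR l * (1 - enorm y) <= expR l * (2 * h) by rewrite ler_pM2l//; lra.
have hE : h <= h * expR l by rewrite ler_peMr//; lra.
have [|u u1 uL] := @hboundary_support _ _ L w ((1 - enorm w) ^+ 2 / 4) LS Bw.
  by rewrite divr_gt0 ?exprn_gt0//; lra.
have [|z z1 [zw zL]] := @half_space_hole u w n1 u1; first by apply/andP; split; lra.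
exists z; split => //.
  apply: le_trans (enorm_dist _ w _) _.
  have := enorm_dist w y x; rewrite (enormB w y) => hw.
  lra.
move=> q Lq; have qz : (1 - enorm w) / 2 <= enorm (q - z).
  rewrite leNgt; apply/negP => qz; have := zL _ (LS _ Lq) qz.
  by apply/negP; rewrite -leNgt; exact: uL.
apply: le_trans qz; rewrite ler_pdivrMr; last first.
  by rewrite exprn_gt0//; lra.
(* The depth of [w] is at least [h / (15 expR l)], so the hole has radius at least
   [s / (3030 expR l ^+ 2)], and 3030 is below 60^2. *)
have yw2 : expR l * (1 - enorm y) <= expR l * (5 * expR l * (1 - enorm w)).
  by rewrite ler_pM2l//; lra.
have hy : expR l * (h / 3) <= expR l * (1 - enorm y) by rewrite ler_pM2l//; lra.
have E2 : expR l * h <= 15 * expR l ^+ 2 * (1 - enorm w) by lra.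
have w0 : 0 <= expR l ^+ 2 * (1 - enorm w) by rewrite mulr_ge0 ?sqr_ge0//; lra.
rewrite -hs exprMn; lra.
Qed.

End Porosity.

(** * Counting dyadic cubes outside holes *)

Section Tree.
Context {R : realType} {T : finType}.
Variable dead : pred (seq T).

(** Words stand for cubes, a further letter for the choice of a child, and [dead] for cubes without
    limit points; liveness is tested at the last level only. *)
Fixpoint alive_words (w : seq T) (k : nat) : seq (seq T) :=
  if k is k'.+1 then flatten [seq alive_words (rcons w t) k' | t <- enum T]
  else if dead w then [::] else [:: w].

Lemma size_alive_wordsS w k :
  size (alive_words w k.+1) = (\sum_(t : T) size (alive_words (rcons w t) k))%N.
Proof.
rewrite /= size_flatten /shape -map_comp sumnE big_map big_enum.
exact: eq_bigl.
Qed.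

Lemma mem_alive_words w v : ~~ dead (w ++ v) -> w ++ v \in alive_words w (size v).
Proof.
elim: v w => [w|t v IH w] /=; first by rewrite cats0 => /negPf ->; rewrite mem_head.
rewrite -cat_rcons => /IH h; apply/flattenP; exists (alive_words (rcons w t) (size v)) => //.
by apply/mapP; exists t; rewrite // mem_enum.
Qed.

Hypothesis dead_cat : forall w v, dead w -> dead (w ++ v).
Variables (a k0 : nat).
Hypothesis dead_below : forall w, (k0 <= size w)%N ->
  exists2 v, size v = a & dead (w ++ v).
Hypothesis T_gt1 : (1 < #|T|)%N.

Let B : R := #|T|%:R.
Let lam : R := B * (1 - (1 - B^-1) * B^-1 ^+ a).

Let B_ge2 : 2 <= B. Proof. by rewrite /B ler_nat. Qed.

Let Bi_gt0 : 0 < B^-1. Proof. by rewrite invr_gt0; have := B_ge2; lra. Qed.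

Let Bi_le : B^-1 <= 2^-1.
Proof. by rewrite lef_pV2 ?posrE//; have := B_ge2; lra. Qed.

Let Bij k : 0 < B^-1 ^+ k <= 1.
Proof. by rewrite exprn_gt0//= exprn_ile1//; have := Bi_gt0; have := Bi_le; lra. Qed.

Let lam_ge0 : 0 <= lam.
Proof.
have /andP[h1 h2] := Bij a; have := Bi_gt0; have := Bi_le; have := B_ge2 => h3 h4 h5.
have h : (1 - B^-1) * B^-1 ^+ a <= 1 by apply: mulr_ile1; lra.
by apply: mulr_ge0; lra.
Qed.

(* A hole of relative measure B^-j inside a cube is inherited by the child
   containing it, where its relative measure is B^(1-j), while every other child has
   a hole of relative measure B^-a; so the measure of the surviving cubes minus
   that of their holes is multiplied by at most 1 - (1 - 1/B) B^-a at each step. *)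
Lemma size_alive_words_hole k j w v : (k0 <= size w)%N -> (j <= a)%N ->
  size v = j -> dead (w ++ v) ->
  (size (alive_words w k))%:R <= 2 * lam ^+ k * (1 - B^-1 ^+ j).
Proof.
elim: k j w v => [|k IH] j w v kw ja vj dv.
  rewrite /= expr0 mulr1; case: j vj ja => [|j] vj ja.
    by move: dv; rewrite (size0nil vj) cats0 => ->; rewrite expr0 subrr mulr0.
  (* The factor 2 of the bound pays for this start: [1 - B^-1 >= 1/2]. *)
  have /andP[_ h] := Bij j; have := Bi_gt0; have := Bi_le => h1 h2.
  have : B^-1 ^+ j.+1 <= 2^-1 by rewrite exprS -[leRHS]mulr1 ler_pM// ?exprn_ge0// ltW.
  by case: ifP => _ /=; lra.
have dw v' : dead w -> dead (w ++ v') by exact: dead_cat.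
case: v vj dv => [|t v] vj dv.
  rewrite -vj expr0 subrr mulr0 size_alive_wordsS.
  rewrite cats0 in dv; rewrite big1 // => t _.
  have dt : dead (rcons w t ++ [::]) by rewrite cats0 -cats1 dw.
  have := IH 0%N (rcons w t) [::] _ (leq0n a) erefl dt; rewrite expr0 subrr mulr0.
  rewrite size_rcons => /(_ (leqW kw)) h; apply/eqP; rewrite -leqn0.
  by rewrite -(ler_nat R).
rewrite size_alive_wordsS natr_sum (bigD1 t)//=.
have kt t' : (k0 <= size (rcons w t'))%N by rewrite size_rcons leqW.
have h1 : (size (alive_words (rcons w t) k))%:R <= 2 * lam ^+ k * (1 - B^-1 ^+ j.-1).
  apply: IH (kt t) _ _ _; rewrite -?vj//=; first by rewrite -vj in ja; exact: ltnW.
  by rewrite cat_rcons.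
have h2 : \sum_(t' | t' != t) (size (alive_words (rcons w t') k))%:R <=
    (B - 1) * (2 * lam ^+ k * (1 - B^-1 ^+ a)) :> R.
  have -> : B - 1 = #|[pred t' | t' != t]|%:R.
    rewrite /B -(cardC (pred1 t)) card1 natrD addrC addKr; congr _%:R.
  rewrite mulr_natl -sumr_const; apply: ler_sum => t' _.
  have [v' v'a dv'] := dead_below (kt t').
  exact: IH (kt t') (leqnn a) v'a dv'.
apply: le_trans (lerD h1 h2) _.
have -> : B^-1 ^+ j = B^-1 * B^-1 ^+ j.-1 by rewrite -exprS -vj.
have BB : B * B^-1 = 1 by rewrite mulfV// gt_eqF//; have := B_ge2; lra.
set p := B^-1 ^+ j.-1; set q := B^-1 ^+ a.
rewrite -subr_ge0 exprS [X in 0 <= X](_ : _ =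
  2 * lam ^+ k * ((1 - B * B^-1) * (p - q) + B * (1 - B^-1) * q * (B^-1 * p))); last first.
  rewrite {1}/lam -/q; ring.
have /andP[p0 _] := Bij j.-1; have /andP[q0 _] := Bij a.
rewrite BB subrr mul0r add0r; apply: mulr_ge0; first by rewrite mulr_ge0 ?exprn_ge0 ?lam_ge0.
apply: mulr_ge0; last by rewrite mulr_ge0// ltW.
apply: mulr_ge0; last exact: ltW.
by apply: mulr_ge0; have := Bi_le; have := B_ge2; lra.
Qed.

(** No holes are available in the first [k0] generations, so there each cube is charged with all its
    [B] children. *)
Lemma size_alive_words k :
  (size (alive_words [::] (k0 + k)))%:R <= B ^+ k0 * 2 * lam ^+ k.
Proof.
suff h i w : (k0 <= size w + i)%N ->
    (size (alive_words w (i + k)))%:R <= B ^+ i * 2 * lam ^+ k.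
  exact: h.
elim: i w => [|i IH] w hw.
  rewrite add0n expr0 mul1r; rewrite addn0 in hw.
  have [v va dv] := dead_below hw; apply: le_trans (size_alive_words_hole k hw (leqnn a) va dv) _.
  rewrite ler_piMr ?mulr_ge0 ?exprn_ge0 ?lam_ge0//; have /andP[] := Bij a; lra.
rewrite addSn size_alive_wordsS natr_sum.
apply: le_trans (ler_sum _ _) _ => [t _|]; first by apply: IH; rewrite size_rcons addSnnS.
rewrite sumr_const -mulr_natl -/B exprS; lra.
Qed.

End Tree.

(** * Dyadic subcubes and the charts of the sphere by the faces of a cube *)

Section Charts.
Context {R : realType} {n : nat}.
Local Notation word := (seq {ffun 'I_n -> bool}).
Implicit Types (c y : 'I_n -> R) (r : R) (w v : word) (b : bool) (i : 'I_n.+1) (x z : 'rV[R]_n.+1).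

(** Here [r] is half the side. A letter selects an orthant, that is, a half in every coordinate, and
    halves [r]. *)
Fixpoint cube_center c r w : 'I_n -> R :=
  if w is t :: w' then cube_center (fun j => c j + (-1) ^+ t j * (r / 2)) (r / 2) w'
  else c.

Lemma cube_center_cat c r w v :
  cube_center c r (w ++ v) = cube_center (cube_center c r w) (r / 2 ^+ size w) v.
Proof.
elim: w c r => [|t w IH] c r /=; first by rewrite expr0 divr1.
by rewrite IH; congr cube_center; rewrite exprS; field; rewrite expf_neq0.
Qed.

Lemma cube_center_dist c r w j : 0 <= r ->
  `|cube_center c r w j - c j| <= r - r / 2 ^+ size w.
Proof.
elim: w c r => [|t w IH] c r r0 /=; first by rewrite expr0 divr1 !subrr normr0.
have r2 : 0 <= r / 2 by rewrite divr_ge0.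
have := IH (fun j => c j + (-1) ^+ t j * (r / 2)) _ r2.
have s2 : `|c j + (-1) ^+ t j * (r / 2) - c j| = r / 2.
  by rewrite addrAC subrr add0r normrM normrX normrN1 expr1n mul1r (ger0_norm r2).
move=> h; apply: le_trans (ler_distD (c j + (-1) ^+ t j * (r / 2)) _ _) _.
have e : r / 2 ^+ (size w).+1 = r / 2 / 2 ^+ size w by rewrite exprS invfM mulrA.
rewrite s2 e; lra.
Qed.

Lemma exists_subcube c r y : (forall j, `|y j - c j| <= r) ->
  exists t : {ffun 'I_n -> bool}, forall j, `|y j - (c j + (-1) ^+ t j * (r / 2))| <= r / 2.
Proof.
move=> h; exists [ffun j => y j < c j] => j; have := h j.
rewrite !ler_norml ffunE; case: ltP => /=; rewrite ?expr1 ?expr0 => h1 /andP[h2 h3];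
  by apply/andP; split; lra.
Qed.

Lemma exists_cube k c r y : (forall j, `|y j - c j| <= r) ->
  exists2 w, size w = k & forall j, `|y j - cube_center c r w j| <= r / 2 ^+ k.
Proof.
elim: k c r => [|k IH] c r h; first by exists [::] => // j; rewrite expr0 divr1.
have [t ht] := exists_subcube h.
have [w wk hw] := IH _ _ ht; exists (t :: w) => /=; first by rewrite wk.
by move=> j; rewrite exprS invfM mulrA.
Qed.

Definition face_point i b y : 'rV[R]_n.+1 :=
  \row_j (if unlift i j is Some k then y k else (-1) ^+ b).

Definition sphere_proj (x : 'rV[R]_n.+1) : 'rV[R]_n.+1 := (enorm x)^-1 *: x.

(** The cone over the face of [[-1, 1]^(n+1)] on which coordinate [i] has sign [(-1) ^+ b] and is
    largest in absolute value. *)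
Definition in_face i b (x : 'rV[R]_n.+1) := forall j, `|x 0 j| <= (-1) ^+ b * x 0 i.

Definition face_coord i b (x : 'rV[R]_n.+1) : 'I_n -> R :=
  fun k => x 0 (lift i k) / ((-1) ^+ b * x 0 i).

Lemma face_point_coord i b x : 0 < (-1) ^+ b * x 0 i ->
  face_point i b (face_coord i b x) = ((-1) ^+ b * x 0 i)^-1 *: x.
Proof.
move=> x0; apply/rowP => j; rewrite !mxE; case: unliftP => [k ->|->].
  by rewrite mulrC.
apply: (mulfI (lt0r_neq0 x0)); rewrite mulVKf ?gt_eqF//.
by rewrite mulrAC -expr2 sqrr_sign mul1r.
Qed.

Lemma sphere_proj_face_point i b x : dotr x x = 1 -> 0 < (-1) ^+ b * x 0 i ->
  sphere_proj (face_point i b (face_coord i b x)) = x.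
Proof.
move=> x1 x0; rewrite face_point_coord// /sphere_proj enormZ (enorm1 x).2// mulr1.
by rewrite gtr0_norm ?invr_gt0// invrK scalerA mulfV ?scale1r// gt_eqF.
Qed.

Lemma enorm_face_point i b y : 1 <= enorm (face_point i b y).
Proof.
apply: le_trans (coord_le_enorm _ i); rewrite mxE.
by case: unliftP => [k /eqP|_]; [rewrite eq_liftF | rewrite normrX normrN1 expr1n].
Qed.

Lemma sphere_proj_lipschitz x z : 1 <= enorm x -> 1 <= enorm z ->
  enorm (sphere_proj x - sphere_proj z) <= 2 * enorm (x - z).
Proof.
move=> x1 z1; rewrite /sphere_proj.
have -> : (enorm x)^-1 *: x - (enorm z)^-1 *: z =
    (enorm x)^-1 *: (x - z) + ((enorm x)^-1 * (enorm z - enorm x) / enorm z) *: z.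
  by apply/rowP => j; rewrite !mxE; field; apply/andP; split; lra.
have xi : (enorm x)^-1 <= 1 by rewrite invf_le1//; lra.
have xi0 : 0 <= (enorm x)^-1 by rewrite invr_ge0; lra.
have e0 := enorm_ge0 (x - z).
apply: le_trans (enormD _ _) _; rewrite !enormZ !normrM !normfV !(ger0_norm (enorm_ge0 _)).
rewrite mulfVK; last by rewrite gt_eqF//; lra.
have h : `|enorm z - enorm x| <= enorm (x - z).
  have := enorm_le_dist x z; have := enorm_le_dist z x; rewrite (enormB z x).
  by rewrite ler_norml => ? ?; apply/andP; split; lra.
have h1 : (enorm x)^-1 * enorm (x - z) <= enorm (x - z) by rewrite ler_piMl.
have h2 : (enorm x)^-1 * `|enorm z - enorm x| <= enorm (x - z).
  by apply: le_trans h; rewrite ler_piMl.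
lra.
Qed.

Lemma face_point_dist i b y y' r : 0 <= r -> (forall k, `|y k - y' k| <= r) ->
  enorm (sphere_proj (face_point i b y) - sphere_proj (face_point i b y')) <=
  2 * n.+1%:R * r.
Proof.
move=> r0 h; apply: le_trans (sphere_proj_lipschitz _ _) _; try exact: enorm_face_point.
rewrite -mulrA ler_pM2l//; apply: enorm_le_sup => // j; rewrite !mxE.
by case: unliftP => [k _|_]; rewrite ?subrr ?normr0.
Qed.

Lemma exists_face x : dotr x x = 1 -> exists i b, in_face i b x /\ 0 < (-1) ^+ b * x 0 i.
Proof.
move=> x1; pose i := [arg max_(j > (ord0 : 'I_n.+1)) `|x 0 j|]%O.
have hi j : `|x 0 j| <= `|x 0 i|.
  by rewrite /i; case: arg_maxP => //= k _ hk; exact: hk.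
have bE : (-1) ^+ (x 0 i < 0)%R * x 0 i = `|x 0 i| by rewrite normrEsign ?num_real.
exists i, (x 0 i < 0); rewrite /in_face bE; split=> //.
rewrite lt_neqAle normr_ge0 andbT; apply/eqP => i0.
have : x = 0.
  apply/rowP => j; apply/eqP; rewrite mxE -normr_eq0 eq_le normr_ge0 andbT.
  by rewrite i0 hi.
by move=> x0; move: x1; rewrite x0 dotr0l => /eqP; rewrite eq_sym oner_eq0.
Qed.

End Charts.

(** * Live cubes of a porous subset of the sphere *)

Section Covering.
Context {R : realType} {n : nat}.
Variable L : set 'rV[R]_n.+1.
Hypothesis LS : L `<=` usphere.
Local Notation word := (seq {ffun 'I_n -> bool}).
Implicit Types (w v : word) (b : bool) (i : 'I_n.+1) (x y z : 'rV[R]_n.+1).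

Definition cube w : 'I_n -> R := cube_center (fun=> 0) 1 w.

Definition cube_misses i b w : bool :=
  `[< forall x, L x -> in_face i b x -> 0 < (-1) ^+ b * x 0 i ->
      exists j, 2^-1 ^+ size w < `|face_coord i b x j - cube w j| >].

Lemma cube_cat w v : cube (w ++ v) = cube_center (cube w) (2^-1 ^+ size w) v.
Proof. by rewrite /cube cube_center_cat mul1r exprVn. Qed.

Lemma cube_misses_cat i b w v : cube_misses i b w -> cube_misses i b (w ++ v).
Proof.
move=> /asboolP h; apply/asboolP => x Lx xf x0; have [j hj] := h x Lx xf x0; exists j.
have h0 : 0 <= 2^-1 ^+ size w :> R by rewrite exprn_ge0.
have := cube_center_dist (cube w) v j h0; rewrite -cube_cat => h1.
have h2 : 2^-1 ^+ size (w ++ v) = 2^-1 ^+ size w / 2 ^+ size v :> R.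
  by rewrite size_cat exprD !exprVn.
have := ler_distD (cube (w ++ v) j) (face_coord i b x j) (cube w j).
rewrite h2; lra.
Qed.

Lemma cube_le1 w j : `|cube w j| <= 1.
Proof.
have := @cube_center_dist R n (fun=> 0) 1 w j ler01; rewrite subr0 => h.
by apply: le_trans h _; rewrite lerBlDr lerDl divr_ge0// exprn_ge0.
Qed.

Definition cube_point i b w := sphere_proj (face_point i b (cube w)).

Lemma cube_point_usphere i b w : usphere (cube_point i b w).
Proof.
apply: dotr_normalize; apply/eqP => h; have := enorm_face_point i b (cube w).
by rewrite h /enorm dotr0l sqrtr0 ler10.
Qed.

Lemma face_coord_cube_point i b w :
  0 < (-1) ^+ b * cube_point i b w 0 i /\ n.+1%:R^-1 <= (-1) ^+ b * cube_point i b w 0 i /\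
  forall k, cube_point i b w 0 (lift i k) = cube w k * ((-1) ^+ b * cube_point i b w 0 i).
Proof.
set Z := face_point i b (cube w).
have Z1 : 1 <= enorm Z by exact: enorm_face_point.
have Zm : enorm Z <= n.+1%:R.
  rewrite -[leRHS]mulr1; apply: enorm_le_sup => // j; rewrite mxE.
  case: unliftP => [k _|_]; first exact: cube_le1.
  by rewrite normrX normrN1 expr1n.
have pE : (-1) ^+ b * cube_point i b w 0 i = (enorm Z)^-1.
  rewrite /cube_point /sphere_proj -/Z mxE mulrCA mxE unlift_none -expr2 sqrr_sign.
  by rewrite mulr1.
rewrite pE; split; first by rewrite invr_gt0; lra.
split; first by rewrite lef_pV2 ?posrE ?ltr0n//; lra.
by move=> k; rewrite /cube_point /sphere_proj -/Z mxE mxE liftK mulrC.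
Qed.

Definition cover_points k : seq 'rV[R]_n.+1 :=
  flatten [seq [seq cube_point ib.1 ib.2 w | w <- alive_words (cube_misses ib.1 ib.2) [::] k]
          | ib <- enum {: 'I_n.+1 * bool}].

Lemma size_cover_points k : size (cover_points k) =
  (\sum_(ib : 'I_n.+1 * bool) size (alive_words (cube_misses ib.1 ib.2) [::] k))%N.
Proof.
rewrite size_flatten /shape -map_comp sumnE big_map big_enum.
by apply: eq_bigr => ib _; rewrite /= size_map.
Qed.

Lemma cover_points_usphere k x : x \in cover_points k -> usphere x.
Proof. by move=> /flattenP[_ /mapP[ib _ ->] /mapP[w _ ->]]; exact: cube_point_usphere. Qed.

Lemma cover_pointsP k x : L x ->
  exists2 y, y \in cover_points k & enorm (y - x) <= 2 * n.+1%:R * 2^-1 ^+ k.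
Proof.
move=> Lx; have [i [b [xf x0]]] := exists_face (LS Lx).
have xc j : `|face_coord i b x j - 0| <= 1.
  rewrite subr0 /face_coord normrM normfV (gtr0_norm x0) ler_pdivrMr// mul1r.
  exact: xf.
have [w wk hw] := exists_cube k xc.
rewrite div1r -exprVn in hw; exists (cube_point i b w).
  apply/flattenP; exists [seq cube_point i b w | w <- alive_words (cube_misses i b) [::] k].
    by apply/mapP; exists (i, b) => //; rewrite mem_enum.
  apply/mapP; exists w => //; rewrite -wk; apply: (@mem_alive_words _ _ [::]).
  apply/asboolPn => h; have [j] := h x Lx xf x0; rewrite wk.
  by apply/negP; rewrite -leNgt; exact: hw.
rewrite -{1}(sphere_proj_face_point (LS Lx) x0) enormB.
by apply: face_point_dist hw; rewrite exprn_ge0.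
Qed.

Variables (s0 E : R) (k0 a : nat).
Hypothesis E_ge1 : 1 <= E.
Hypothesis porous : forall x s, L x -> 0 < s -> s <= s0 ->
  exists y, [/\ usphere y, enorm (y - x) <= s & forall z, L z -> s / E <= enorm (z - y)].
Hypothesis k0_s0 : 2^-1 ^+ k0 <= s0.
Hypothesis a_E : 32 * n.+1%:R ^+ 2 * E < 2 ^+ a.

Let E_gt0 : 0 < E. Proof. exact: lt_le_trans ltr01 E_ge1. Qed.

(** Porosity is given at points of [L] only. Either such a point is within [s / 2] of [x] and lends
    its hole, or [x] is itself the centre of one. *)
Lemma hole_near_sphere_point x s : usphere x -> 0 < s -> s <= s0 ->
  exists y, [/\ usphere y, enorm (y - x) <= s & forall z, L z -> s / 2 / E <= enorm (z - y)].
Proof.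
move=> x1 sp ss0; have s2 : s / 2 / E <= s / 2.
  by apply: ler_piMr; [lra | rewrite invf_le1// E_gt0].
have [[z Lz zx]|h] := pselect (exists2 z, L z & enorm (z - x) <= s / 2).
  have [||y [y1 yz yL]] := @porous z (s / 2) Lz; [lra|lra|].
  by exists y; split => //; apply: le_trans (enorm_dist _ z _) _; lra.
exists x; split => //; first by rewrite subrr /enorm dotr0l sqrtr0 ltW.
move=> z Lz; apply: le_trans s2 _.
by apply: ltW; rewrite ltNge; apply/negP => ?; apply: h; exists z.
Qed.

(** A hole near the projected centre of the cube has its own centre [y] over the cube; the subcube
    [a] levels down that contains the coordinates of [y] is small enough to fit in the hole. *)
Lemma cube_misses_below i b w : (k0 <= size w)%N ->
  exists2 v, size v = a & cube_misses i b (w ++ v).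
Proof.
move=> kw; have [p0 [pm pc]] := face_coord_cube_point i b w.
set p := cube_point i b w in p0 pm pc; set h := 2^-1 ^+ size w : R.
have m0 : 0 < n.+1%:R :> R by rewrite ltr0n.
have m1 : 1 <= n.+1%:R :> R by rewrite ler1n.
have mi : n.+1%:R^-1 * n.+1%:R = 1 :> R by rewrite mulVf// gt_eqF.
have h0 : 0 < h by rewrite exprn_gt0.
have h1 : h <= 1 by rewrite exprn_ile1//; lra.
have hk : h <= 2^-1 ^+ k0.
  by rewrite /h -(subnK kw) exprD ler_piMl ?exprn_ge0 ?exprn_ile1//; lra.
move: pm mi a_E m0 m1; set m : R := n.+1%:R => pm mi aE m0 m1.
have mE : n.+1%:R = m by [].
clearbody m.
(* Coordinate [i] of [p] is at least [1/m] in absolute value, so that of [y] stays above [3/(4m)].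
   Chart coordinates then move by at most [2 s] divided by this, which is below [h]. *)
pose s := h / (4 * m).
have sh : s * (4 * m) = h by rewrite divfK// gt_eqF// mulr_gt0.
have sp : 0 < s by rewrite divr_gt0// mulr_gt0.
have s1 : s <= h by rewrite -sh ler_peMr; lra.
have ss0 : s <= s0 by exact: le_trans s1 (le_trans hk k0_s0).
have [y [y1 yp yL]] := hole_near_sphere_point (cube_point_usphere i b w) sp ss0.
rewrite -/p in yp.
have cy j : `|y 0 j - p 0 j| <= s.
  by apply: le_trans yp; have := coord_le_enorm (y - p) j; rewrite !mxE.
have e1 (q : R) : `|(-1) ^+ b * q| = `|q| by rewrite normrM normrX normrN1 expr1n mul1r.
have yA : `|(-1) ^+ b * y 0 i - (-1) ^+ b * p 0 i| <= s by rewrite -mulrBr e1.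
move: yA p0 pm pc; set B := (-1) ^+ b * p 0 i; set A := (-1) ^+ b * y 0 i => yA p0 pm pc.
have sm : s = h / 4 * m^-1.
  by rewrite /s invfM mulrA.
have A0 : 3 / 4 * m^-1 <= A.
  have : s <= 4^-1 * m^-1 by rewrite sm ler_pM2r ?invr_gt0//; lra.
  move: yA; rewrite ler_norml => /andP[? ?]; lra.
have mi0 : 0 < m^-1 by rewrite invr_gt0.
have Ap : 0 < A by lra.
have yc j : `|face_coord i b y j - cube w j| <= h.
  rewrite /face_coord -/A.
  have -> : y 0 (lift i j) / A - cube w j =
      ((y 0 (lift i j) - p 0 (lift i j)) + cube w j * (B - A)) / A.
    by rewrite pc; field; lra.
  rewrite normrM normfV (gtr0_norm Ap) ler_pdivrMr//.
  apply: le_trans (ler_normD _ _) _; rewrite normrM (distrC B).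
  have c1 : `|cube w j| * `|A - B| <= 1 * s by rewrite ler_pM// cube_le1.
  have := cy (lift i j).
  have : h * (3 / 4 * m^-1) <= h * A by rewrite ler_pM2l.
  rewrite sm; lra.
have [v va hv] := exists_cube a yc; exists v => //.
apply/asboolP => x Lx xf x0; apply: contrapT => hx.
have hv' : h / 2 ^+ a = 2^-1 ^+ size (w ++ v) by rewrite /h size_cat va exprD !exprVn.
have xv j : `|face_coord i b x j - cube (w ++ v) j| <= h / 2 ^+ a.
  by rewrite hv' leNgt; apply/negP => ?; apply: hx; exists j.
have a0 : 0 < 2 ^+ a :> R by rewrite exprn_gt0.
have xy j : `|face_coord i b x j - face_coord i b y j| <= 2 * (h / 2 ^+ a).
  have := ler_distD (cube (w ++ v) j) (face_coord i b x j) (face_coord i b y j).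
  have := hv j; have := xv j; rewrite cube_cat -/h (distrC (face_coord i b y j)); lra.
have hp : 0 <= 2 * (h / 2 ^+ a) by rewrite mulr_ge0// divr_ge0 ?ltW.
have := face_point_dist i b hp xy.
rewrite (sphere_proj_face_point (LS Lx) x0) (sphere_proj_face_point y1 Ap) mE.
apply/negP; rewrite -ltNge; apply: lt_le_trans (yL _ Lx).
have E0 := E_gt0.
rewrite ltr_pdivlMr// ltr_pdivlMr//.
(* The projected subcube has diameter at most [4 m h / 2^a]; this is below [s / (2 E)] exactly when
   [32 m^2 E < 2^a]. *)
have -> : 2 * m * (2 * (h / 2 ^+ a)) * E * 2 = s * (32 * m ^+ 2 * E / 2 ^+ a).
  by rewrite -sh; field; lra.
by rewrite gtr_pMr// ltr_pdivrMr// mul1r.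
Qed.

Lemma size_cover_points_porous : (1 <= n)%N -> exists2 K : R, 0 < K &
  forall k, (size (cover_points (k0 + k)))%:R <=
    K * (2 ^+ n * (1 - (1 - 2^-1 ^+ n) * 2^-1 ^+ n ^+ a)) ^+ k.
Proof.
move=> n1; have cT : #|{ffun 'I_n -> bool}|%:R = 2 ^+ n :> R.
  by rewrite card_ffun card_bool card_ord natrX.
have T1 : (1 < #|{ffun 'I_n -> bool}|)%N.
  by rewrite card_ffun card_bool card_ord -{1}(expn0 2) ltn_exp2l.
pose K : R := \sum_(ib : 'I_n.+1 * bool) (2 ^+ n) ^+ k0 * 2.
exists (K + 1) => [|k].
  by rewrite ltr_wpDl// sumr_ge0// => ib _; rewrite mulr_ge0 ?exprn_ge0.
set l := 2 ^+ n * _; have l0 : 0 <= l.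
  rewrite mulr_ge0 ?exprn_ge0// subr_ge0 -exprM.
  have h q : 0 <= (2^-1 : R) ^+ q <= 1 by rewrite exprn_ge0//= exprn_ile1//; lra.
  have /andP[h1 h2] := h n; have /andP[h3 h4] := h (n * a)%N.
  by apply: mulr_ile1; lra.
apply: (@le_trans _ _ (K * l ^+ k)); last by rewrite ler_wpM2r ?exprn_ge0//; lra.
rewrite size_cover_points natr_sum /K mulr_suml; apply: ler_sum => -[i b] _ /=.
have := @size_alive_words R _ (cube_misses i b) (@cube_misses_cat i b) a k0
  (@cube_misses_below i b) T1 k.
by rewrite cT -exprVn.
Qed.

End Covering.

(** * Hyperbolic volume and boxes *)

Section Volume.
Context {R : realType}.
Local Notation tupleR m := (m.-tuple (measurableTypeR R)).

Definition tuple_box m (c : 'I_m -> R) (r : R) : set (tupleR m) :=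
  [set t | forall i, `|tnth t i - c i| <= r].

Lemma measurable_tuple_box m (c : 'I_m -> R) (r : R) : measurable (tuple_box c r).
Proof.
have -> : tuple_box c r = \bigcap_(i in [set: 'I_m])
    ((fun t : tupleR m => tnth t i) @^-1` `[c i - r, c i + r]%classic).
  apply/seteqP; split=> t h i; have := h i.
    by move=> h' _; rewrite /= in_itv/= -ler_distl.
  by move=> /(_ Logic.I); rewrite /= in_itv/= -ler_distl.
apply: fin_bigcap_measurable => // i _; rewrite -[X in measurable X]setTI.
by apply: measurable_tnth => //; exact: measurable_itv.
Qed.

Lemma lebesgue_tuple_box m (c : 'I_m -> R) (r : R) : 0 <= r ->
  lebesgue_tuple (tuple_box c r) = ((2 * r) ^+ m)%:E.
Proof.
move=> r0; elim: m c => [|m IH] c.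
  rewrite /= diracE expr0 mem_set//; by case.
pose c' (i : 'I_m) := c (lift ord0 i).
have e : cons_pair @^-1` (tuple_box c r) =
    `[c ord0 - r, c ord0 + r]%classic `*` tuple_box c' r.
  apply/seteqP; split=> -[x t] /= h.
    split=> [|i]; first by have := h ord0; rewrite tnth0 in_itv/= ler_distl.
    by have := h (lift ord0 i); rewrite tnthS.
  move=> i; case: (unliftP ord0 i) => [j ->|->].
    by rewrite tnthS; exact: h.2.
  by rewrite tnth0 ler_distl; have := h.1; rewrite in_itv.
rewrite /= /pushforward e product_measure1E//; last exact: measurable_tuple_box.
rewrite exprS EFinM; congr (_ * _)%E; last exact: IH.
apply: etrans (lebesgue_measure_itv _) _ => /=; rewrite lte_fin.
case: ifPn => [_|]; first by rewrite -EFinB; congr EFin; ring.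
by rewrite -leNgt => h; congr EFin; lra.
Qed.

(** Read off the supremum over simple functions, so that it applies to the sets [A] below, whose
    measurability is never established. *)
Lemma ge0_subset_integral (d : measure_display) (T : measurableType d)
    (mu : {measure set T -> \bar R}) (D D' : set T) (f g : T -> \bar R) :
  (forall x, D x -> (0 <= f x)%E) -> (forall x, D' x -> (0 <= g x)%E) ->
  (forall x, ((f \_ D) x <= (g \_ D') x)%E) ->
  (\int[mu]_(x in D) f x <= \int[mu]_(x in D') g x)%E.
Proof.
move=> f0 g0 fg; rewrite !ge0_integralE//; apply: ereal_sup_le => _ [h hf <-].
by exists h => // x; exact: le_trans (hf x) (fg x).
Qed.

Context {m : nat}.
Implicit Types (c x : 'rV[R]_m) (A : set 'rV[R]_m).

Definition cbox c (r : R) : set 'rV[R]_m := [set x | forall i, `|x 0 i - c 0 i| <= r].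

Let tbox c (r : R) := tuple_box (fun i => c 0 i) r.

Let tboxE c r (t : tupleR m) : tbox c r t <-> cbox c r (\row_i tnth t i).
Proof. by split=> h i; have := h i; rewrite mxE. Qed.

Lemma cbox_enorm c r x : enorm (x - c) <= r -> cbox c r x.
Proof. by move=> h i; apply: le_trans h; have := coord_le_enorm (x - c) i; rewrite !mxE. Qed.

Lemma enorm_cbox c r x : 0 <= r -> cbox c r x -> enorm (x - c) <= m%:R * r.
Proof. by move=> r0 h; apply: enorm_le_sup => // i; rewrite !mxE. Qed.

Let integral_boxes (I : Type) (s : seq I) (c : I -> 'rV[R]_m) (r k : I -> R) :
  (forall i, 0 <= r i) -> (forall i, 0 <= k i) ->
  (\int[@lebesgue_tuple R m]_t (\sum_(i <- s) k i * \1_(tbox (c i) (r i)) t)%:E =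
   (\sum_(i <- s) k i * (2 * r i) ^+ m)%:E)%E.
Proof.
move=> r0 k0; under eq_integral do rewrite -sumEFin.
rewrite ge0_integral_sum//=; last 2 first.
- move=> i; apply/measurable_EFinP; apply: measurable_funM => //.
  exact: measurable_indic (measurable_tuple_box _ _).
- by move=> i t _; rewrite lee_fin mulr_ge0.
rewrite -sumEFin; apply: eq_bigr => i _.
under eq_integral do rewrite EFinM.
rewrite ge0_integralZl_EFin//.
- rewrite integral_indic//; last exact: measurable_tuple_box.
  by rewrite setIT EFinM; congr (_ * _)%E; exact: lebesgue_tuple_box.
- by apply/measurable_EFinP; exact: measurable_indic (measurable_tuple_box _ _).
Qed.

(** On [A] the density is dominated by the step function of the boxes, whose integral is explicit;
    [k i] has to bound the density only at the points assigned to box [i]. *)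
Lemma hvol_le_boxes A (I : eqType) (s : seq I) (c : I -> 'rV[R]_m) (r k : I -> R) (M : R) :
  A `<=` uball -> (forall i, 0 <= r i) -> (forall i, 0 <= k i) ->
  (forall i, k i * (2 * r i) ^+ m <= M) ->
  (forall x, A x -> exists2 i, i \in s & cbox (c i) (r i) x /\ (2 / (1 - dotr x x)) ^+ m <= k i) ->
  (hvol A <= ((size s)%:R * M)%:E)%E.
Proof.
move=> Ab r0 k0 kM AS.
apply: (@le_trans _ _ (\sum_(i <- s) k i * (2 * r i) ^+ m)%:E); last first.
  rewrite lee_fin -sum1_size natr_sum mulr_suml; apply: ler_sum => i _.
  by rewrite mul1r.
rewrite -(integral_boxes s c r0 k0) /hvol; apply: ge0_subset_integral => //=.
- move=> t /Ab; rewrite /uball/= => h; rewrite lee_fin exprn_ge0// divr_ge0//; lra.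
- move=> t _; rewrite lee_fin; apply: sumr_ge0 => i _; rewrite mulr_ge0//.
move=> t; rewrite patch_setT /patch; case: ifPn => [|_]; last first.
  by rewrite lee_fin; apply: sumr_ge0 => i _; rewrite mulr_ge0.
rewrite inE => /AS[i si [xi ki]]; rewrite lee_fin; apply: le_trans ki _.
rewrite (big_rem i)//= indicE mem_set ?mulr1; last exact/tboxE.
by rewrite lerDl; apply: sumr_ge0 => j _; rewrite mulr_ge0.
Qed.

Lemma hvol_ge_boxes A (s : seq 'rV[R]_m) (r M : R) : A `<=` uball -> uniq s ->
  0 < r -> 0 <= M ->
  (forall c x, c \in s -> cbox c r x -> A x /\ M <= (2 / (1 - dotr x x)) ^+ m * (2 * r) ^+ m) ->
  (forall c c' x, c \in s -> c' \in s -> cbox c r x -> cbox c' r x -> c = c') ->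
  (((size s)%:R * M)%:E <= hvol A)%E.
Proof.
move=> Ab us r0 M0 sA sd.
have rp : 0 < (2 * r) ^+ m by rewrite exprn_gt0// mulr_gt0.
pose k := M / (2 * r) ^+ m.
have k0 : 0 <= k by rewrite divr_ge0// ltW.
apply: (@le_trans _ _ (\sum_(c <- s) k * (2 * r) ^+ m)%:E).
  rewrite lee_fin -sum1_size natr_sum mulr_suml; apply: ler_sum => c _.
  by rewrite mul1r divfK// gt_eqF.
rewrite -(integral_boxes s id (fun=> ltW r0) (fun=> k0)) /hvol; apply: ge0_subset_integral => //=.
- by move=> t _; rewrite lee_fin; apply: sumr_ge0 => i _; rewrite mulr_ge0.
- by move=> t /Ab; rewrite /uball/= => h; rewrite lee_fin exprn_ge0// divr_ge0//; lra.
move=> t; rewrite patch_setT.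
have [[c cs tc]|h] := pselect (exists2 c, c \in s & tbox c r t); last first.
  rewrite big_seq big1 => [|c cs]; last first.
    rewrite indicE memNset ?mulr0// => tc; apply: h; by exists c.
  rewrite /patch; case: ifPn => [|//]; rewrite inE => /Ab; rewrite /uball/= => ht.
  by rewrite lee_fin exprn_ge0// divr_ge0//; lra.
have [At Mt] := sA _ _ cs ((tboxE c r t).1 tc).
rewrite /patch mem_set//= (bigD1_seq c)//= indicE mem_set// mulr1 big_seq_cond big1 ?addr0.
  by rewrite lee_fin ler_pdivrMr.
move=> c' /andP[cs' /eqP cc']; rewrite indicE memNset ?mulr0// => tc'.
by apply: cc'; exact: (sd _ _ _ cs' cs ((tboxE c' r t).1 tc') ((tboxE c r t).1 tc)).
Qed.

End Volume.

(** * Covering numbers *)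

Section SphericalDistance.
Context {R : realType}.

Let sin_mvt (t : R) : 0 <= t -> exists2 c, 0 <= c <= t & sin t = cos c * t.
Proof.
move=> t0; have [|c] := @MVT_segment R sin cos 0 t t0 (fun x _ => is_derive_sin x).
  by apply: continuous_subspaceT; exact: continuous_sin.
by rewrite sin0 !subr0 in_itv => hc ?; exists c.
Qed.

Lemma sin_le_id (t : R) : 0 <= t -> sin t <= t.
Proof. by move=> t0; have [c _ ->] := sin_mvt t0; rewrite ler_piMl// cos_le1. Qed.

(** [cos (2 c) >= 0] gives [cos c >= 1/2] on [[0, t/2]]; this is used in the mean value theorem
    there and in [sin t = 2 sin (t/2) cos (t/2)]. *)
Lemma sin_ge_quarter (t : R) : 0 <= t <= pi / 2 -> t / 4 <= sin t.
Proof.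
move=> /andP[t0 tpi].
have cos_half c : 0 <= c <= t / 2 -> 2^-1 <= cos c.
  move=> /andP[c0 ct].
  have h0 : 0 <= cos c by apply: cos_ge0_pihalf; apply/andP; split; lra.
  have h : 0 <= cos (c *+ 2) by apply: cos_ge0_pihalf; apply/andP; split; lra.
  rewrite cos_mulr2n in h; rewrite leNgt; apply/negP => hc; nra.
have [c hc sE] := sin_mvt (divr_ge0 t0 (ler0n R 2)).
have h1 := cos_half _ hc.
have h2 : 2^-1 <= cos (t / 2) by apply: cos_half; apply/andP; split; lra.
have -> : t = (t / 2) *+ 2 by rewrite -[in RHS]mulr_natr divfK.
rewrite sin_mulr2n sE.
have h3 : 2^-1 * (t / 2) <= cos c * (t / 2) by rewrite ler_wpM2r//; lra.
have h4 : 2^-1 * (cos c * (t / 2)) <= cos (t / 2) * (cos c * (t / 2)).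
  by rewrite ler_wpM2r//; lra.
lra.
Qed.

Context {m : nat}.
Implicit Types (x y : 'rV[R]_m).

Let dotr_usphere x y : usphere x -> usphere y -> -1 <= dotr x y <= 1.
Proof.
move=> /enorm1 x1 /enorm1 y1; have := dotr_enorm_le x y; have := dotr_enorm_ge x y.
by rewrite x1 y1 mulr1 => -> ->.
Qed.

Lemma enorm_sdist x y : usphere x -> usphere y ->
  enorm (x - y) = 2 * sin (sdist x y / 2) /\ 0 <= sdist x y <= pi.
Proof.
move=> x1 y1; have xy := dotr_usphere x1 y1; have [h1 h2] := acos_def xy.
split; last by [].
have [h3 h4] := andP h1.
have s0 : 0 <= sin (sdist x y / 2).
  by apply: sin_ge0_pi; apply/andP; split; rewrite /sdist; lra.
apply/eqP; rewrite -(@eqrXn2 _ 2)// ?enorm_ge0 ?mulr_ge0//; apply/eqP.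
rewrite sqr_enorm_usphere// -h2 -/(sdist x y) exprMn sin2cos2.
have {1}-> : sdist x y = (sdist x y / 2) *+ 2 by rewrite -mulr_natr divfK.
by rewrite cos_mulr2n; ring.
Qed.

Lemma enorm_le_sdist x y : usphere x -> usphere y -> enorm (x - y) <= sdist x y.
Proof.
move=> x1 y1; have [-> /andP[h1 h2]] := enorm_sdist x1 y1.
have := @sin_le_id (sdist x y / 2); rewrite divr_ge0// => /(_ isT); lra.
Qed.

Lemma sdist_le_enorm x y : usphere x -> usphere y -> sdist x y <= 4 * enorm (x - y).
Proof.
move=> x1 y1; have [-> /andP[h1 h2]] := enorm_sdist x1 y1.
have : sdist x y / 2 / 4 <= sin (sdist x y / 2).
  by apply: sin_ge_quarter; apply/andP; split; lra.
lra.
Qed.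

End SphericalDistance.

(** * Finite covers and maximal separated sets *)

Section CoveringNumbers.
Context {R : realType} {n : nat}.
Implicit Types (L : set 'rV[R]_n.+1) (s : seq 'rV[R]_n.+1) (d : R).

Definition is_cover d L s := (forall c, c \in s -> usphere c) /\
  forall x, L x -> exists2 c, c \in s & sdist c x < d.

Lemma covering_number_le d L s : is_cover d L s ->
  (covering_number d L <= ((size s)%:R)%:E)%E.
Proof. by move=> h; apply: ereal_inf_lbound; exists s. Qed.

Lemma is_cover_enorm d L s : L `<=` usphere -> (forall c, c \in s -> usphere c) ->
  (forall x, L x -> exists2 c, c \in s & 4 * enorm (c - x) < d) -> is_cover d L s.
Proof.
move=> LS s1 h; split=> // x Lx; have [c cs cx] := h x Lx; exists c => //.
by apply: le_lt_trans cx; apply: sdist_le_enorm; [exact: s1 | exact: LS].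
Qed.

Lemma is_cover_cover_points L d k : L `<=` usphere ->
  8 * n.+1%:R * 2^-1 ^+ k < d -> is_cover d L (cover_points L k).
Proof.
move=> LS kd; apply: is_cover_enorm => //; first exact: cover_points_usphere.
move=> x Lx; have [c cs cx] := cover_pointsP LS k Lx; exists c => //.
by apply: le_lt_trans kd; move: cx; lra.
Qed.

Lemma exists_pow2_lt (a : R) : 0 < a -> exists k, 2^-1 ^+ k < a.
Proof.
move=> a0; exists (Num.truncn a^-1).+1.
rewrite exprVn -[ltRHS]invrK ltf_pV2 ?posrE ?exprn_gt0 ?invr_gt0//.
have ai : 0 < a^-1 by rewrite invr_gt0.
have /andP[_ h] := truncn_itv (ltW ai).
apply: lt_le_trans h _; rewrite -natrX ler_nat ltnW// ltn_expl//.
Qed.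

(** The infimum runs over natural numbers, and [cover_points] provides a finite cover to start
    from. *)
Lemma covering_number_attained L d : L `<=` usphere -> 0 < d ->
  exists2 s, is_cover d L s & covering_number d L = ((size s)%:R)%:E.
Proof.
move=> LS d0.
have m0 : 0 < 8 * n.+1%:R :> R by rewrite mulr_gt0.
have [k hk] := exists_pow2_lt (divr_gt0 d0 m0).
have ex : exists k, `[< exists2 s, is_cover d L s & size s = k >].
  exists (size (cover_points L k)); apply/asboolP; exists (cover_points L k) => //.
  by apply: is_cover_cover_points => //; rewrite mulrC -ltr_pdivlMr.
case: (ex_minnP ex) => N /asboolP[s cs sN] Nmin; exists s => //.
apply/eqP; rewrite eq_le covering_number_le//=; apply: le_ereal_inf_tmp => _ [s' cs' <-].
by rewrite lee_fin ler_nat sN; apply: Nmin; apply/asboolP; exists s'.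
Qed.

Lemma covering_number_ge1 L d : L !=set0 -> (1 <= covering_number d L)%E.
Proof.
move=> [x Lx]; apply: le_ereal_inf_tmp => _ [s [_ cs] <-].
by rewrite lee_fin ler1n; have [c] := cs x Lx; case: s {cs}.
Qed.

(** Greedy extension, by induction on the room [N - size s] left. In the application [N] comes from
    a volume bound. *)
Lemma exists_maximal_separated L d (N : nat) :
  (forall s, uniq s -> (forall x, x \in s -> L x) ->
    (forall x y, x \in s -> y \in s -> enorm (x - y) < d -> x = y) -> (size s <= N)%N) ->
  0 < d ->
  exists s, [/\ uniq s, forall x, x \in s -> L x,
    forall x y, x \in s -> y \in s -> enorm (x - y) < d -> x = y &
    forall x, L x -> exists2 y, y \in s & enorm (y - x) < d].
Proof.
move=> hN d0.
suff h k s : (N - size s <= k)%N -> uniq s -> (forall x, x \in s -> L x) ->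
    (forall x y, x \in s -> y \in s -> enorm (x - y) < d -> x = y) ->
    exists s, [/\ uniq s, forall x, x \in s -> L x,
      forall x y, x \in s -> y \in s -> enorm (x - y) < d -> x = y &
      forall x, L x -> exists2 y, y \in s & enorm (y - x) < d].
  by apply: (h N [::]) => //; rewrite leq_subr.
elim: k s => [|k IH] s sk us sL sd; have [cov|] := pselect (forall x, L x ->
    exists2 y, y \in s & enorm (y - x) < d); try by exists s.
all: move=> /existsNP[x /not_implyP[Lx nx]].
all: have xs y : y \in s -> d <= enorm (y - x) by
  move=> ys; rewrite leNgt; apply/negP => ?; apply: nx; exists y.
all: have ux : uniq (x :: s) by
  rewrite /= us andbT; apply/negP => /xs; rewrite subrr /enorm dotr0l sqrtr0 leNgt d0.
all: have xL y : y \in x :: s -> L y by rewrite inE => /orP[/eqP ->|/sL].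
all: have xd y z : y \in x :: s -> z \in x :: s -> enorm (y - z) < d -> y = z by
  (rewrite !inE => /orP[/eqP ->|ys] /orP[/eqP ->|zs] // yz;
    [move: yz; rewrite enormB ltNge xs | move: yz; rewrite ltNge xs | exact: sd]).
  have := hN _ ux xL xd; rewrite /=.
  by move: sk; rewrite leqn0 subn_eq0 => /leq_ltn_trans /[apply]; rewrite ltnn.
by apply: (IH (x :: s)) => //=; rewrite subnS; lia.
Qed.

End CoveringNumbers.

(** * Volume against covering numbers *)

Section HyperbolicEstimates.
Context {R : realType} {n : nat}.
Implicit Types (x y z c : 'rV[R]_n.+1) (L : set 'rV[R]_n.+1) (r e : R).

Lemma hdistC x y : hdist x y = hdist y x.
Proof.
by rewrite /hdist -(opprB y x) dotrNl dotrNr opprK (mulrC (1 - dotr x x)).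
Qed.

Lemma hball_depth z r x : uball z -> hball z r x ->
  (1 - enorm z) / 5 * expR (- r) <= 1 - enorm x.
Proof.
move=> bz [bx zx]; have r0 : 0 <= r by apply: le_trans (hdist_ge0 bz bx) (ltW zx).
rewrite hdistC in zx; have [_] := hdist_enorm bx bz r0 (ltW zx).
by rewrite expRN => h; rewrite ler_pdivrMr ?expR_gt0//; lra.
Qed.

Lemma depth_hball z r x : uball z -> 0 <= r -> uball x ->
  20 / (1 - enorm z) * expR (- r) <= 1 - enorm x -> hball z r x.
Proof.
move=> bz r0 bx h; split=> //.
have z1 : enorm z < 1 by rewrite enorm_lt1.
have x1 : enorm x < 1 by rewrite enorm_lt1.
have z0 := enorm_ge0 z; have x0 := enorm_ge0 x.
have {}h : 20 <= expR r * ((1 - enorm x) * (1 - enorm z)).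
  move: h; rewrite expRN ler_pdivrMr ?expR_gt0// ler_pdivrMr; last lra.
  lra.
rewrite /hdist -(sqr_enorm z) -(sqr_enorm x) -sqr_enorm.
have xz : enorm (z - x) ^+ 2 <= 4.
  have := enormD z (- x); rewrite enormN => hz.
  have -> : 4 = 2 ^+ 2 :> R by ring.
  by rewrite ler_sqr ?nnegrE ?enorm_ge0//; lra.
pose a := (1 - enorm z ^+ 2) * (1 - enorm x ^+ 2); rewrite -/a.
have ha : (1 - enorm x) * (1 - enorm z) <= a.
  by rewrite /a mulrC; apply: ler_pM; nra.
have a1 : a <= 1.
  by rewrite /a mulr_ile1// ?lerBlDr ?lerDl ?sqr_ge0// subr_ge0 expr_le1// ltW.
have a0 : 0 < a.
  apply: lt_le_trans ha; apply: mulr_gt0; lra.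
(* As [|z - x|^2 <= 4] and [a <= 1], the argument of [arcosh] is at most [9 / a], while
   [ch r >= expR r / 2 >= 10 / a]. *)
have t1 : 1 + 2 * enorm (z - x) ^+ 2 / a <= 9 / a.
  rewrite ler_pdivlMr// mulrDl mul1r divfK ?gt_eqF//; lra.
apply: arcosh_lt => //; first by
  rewrite lerDl; apply: divr_ge0; [rewrite mulr_ge0 ?sqr_ge0 | exact: ltW].
apply: le_lt_trans t1 _; rewrite ltr_pdivrMr// /ch.
have e0 := expR_gt0 r; have e1 := expR_gt0 (- r).
have : expR r * ((1 - enorm x) * (1 - enorm z)) <= expR r * a by rewrite ler_pM2l.
have : 0 <= expR (- r) * a by rewrite mulr_ge0// ltW.
lra.
Qed.

(** Support in the direction of [y] itself: with [q = |y|], the point [x] obtained satisfies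
    [|x - y|^2 <= (1 - q^2)^2 / (1 + q^2)]. *)
Lemma hull_near_limit_set L y : L `<=` usphere -> hull L y ->
  exists2 x, L x & enorm (y - x) <= 2 * (1 - enorm y).
Proof.
move=> LS Hy; have by_ := hull_uball Hy; have [x Lx h] := hull_supported y LS Hy.
exists x => //; have y1 : enorm y < 1 by rewrite enorm_lt1.
have y0 := enorm_ge0 y.
rewrite -ler_sqr ?nnegrE ?enorm_ge0//; last lra.
rewrite sqr_enorm dotrDl !dotrDr !(dotrNl, dotrNr) (LS _ Lx) (dotrC y x).
move: h; rewrite -!sqr_enorm; set t := dotr x y; set q := enorm y => h.
have q2 : 0 <= q ^+ 2 by exact: sqr_ge0.
have h1 : (q ^+ 2 + 1 - 2 * t) * (1 + q ^+ 2) <= (1 - q ^+ 2) ^+ 2 by lra.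
have h2 : q ^+ 2 + 1 - 2 * t <= (1 - q ^+ 2) ^+ 2.
  have [t0|t0] := leP (q ^+ 2 + 1 - 2 * t) 0; first by apply: le_trans t0 (sqr_ge0 _).
  by apply: le_trans h1; rewrite ler_peMr; lra.
have h3 : (1 - q ^+ 2) ^+ 2 <= (2 * (1 - q)) ^+ 2.
  have q1 : q ^+ 2 <= 1 by rewrite expr_le1//; exact: ltW.
  by rewrite ler_sqr ?nnegrE; have := sqr_ge0 (1 - q); lra.
lra.
Qed.

(** The hull point is within 4 units of [x] and has depth at most 5, hence is within 10 of [L], the
    unit being [expR e] times the depth of [x]. *)
Lemma hnbhd_near_limit_set L e x : L `<=` usphere -> 0 < e -> hnbhd e (hull L) x ->
  exists2 y, L y & enorm (x - y) <= 14 * expR e * (1 - enorm x).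
Proof.
move=> LS e0 [bx [y Hy xy]].
have [h1 h2] := hdist_enorm bx (hull_uball Hy) (ltW e0) (ltW xy).
have [w Lw hw] := hull_near_limit_set LS Hy; exists w => //.
by apply: le_trans (enorm_dist _ y _) _; lra.
Qed.

Lemma hnbhd_ball e : 0 < e -> exists2 d : R, 0 < d & forall L x y,
  uball y -> L y -> enorm (x - y) <= d * (1 - enorm y) -> hnbhd e L x.
Proof.
move=> e0; have E1 : 1 < expR e by rewrite expR_gt1.
have c0 : 0 < ch e - 1.
  have -> : ch e - 1 = (expR e - 1) ^+ 2 / (2 * expR e).
    by rewrite /ch expRN; field; lra.
  by rewrite divr_gt0 ?mulr_gt0 ?exprn_gt0//; lra.
(* With [d <= 1/2] the depth of [x] is at least half that of [y], and [ch (hdist x y) - 1] is at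
   most [4 d]. *)
pose d := Num.min 2^-1 ((ch e - 1) / 8).
have d0 : 0 < d by rewrite lt_min divr_gt0// andbT.
have [d1 d2] : d <= 2^-1 /\ d <= (ch e - 1) / 8 by split; rewrite ge_min lexx ?orbT.
exists d => // L x y by_ Ly xy.
have y1 : enorm y < 1 by rewrite enorm_lt1.
have y0 := enorm_ge0 y.
have hx : (1 - enorm y) / 2 <= 1 - enorm x.
  have := enorm_le_dist x y.
  have : d * (1 - enorm y) <= 2^-1 * (1 - enorm y) by rewrite ler_pM2r; lra.
  lra.
have x1 : enorm x < 1 by lra.
have bx : uball x by rewrite /uball/= -enorm_lt1.
have x0 := enorm_ge0 x.
split=> //; exists y => //; rewrite /hdist -(sqr_enorm x) -(sqr_enorm y) -sqr_enorm.
pose a := (1 - enorm x ^+ 2) * (1 - enorm y ^+ 2); rewrite -/a.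
have ha : (1 - enorm y) ^+ 2 / 2 <= a.
  have : (1 - enorm y) / 2 * (1 - enorm y) <= a by apply: ler_pM; nra.
  lra.
have a0 : 0 < a by apply: lt_le_trans ha; rewrite divr_gt0// exprn_gt0; lra.
have xy2 : enorm (x - y) ^+ 2 <= d * (1 - enorm y) ^+ 2.
  apply: (@le_trans _ _ ((d * (1 - enorm y)) ^+ 2)).
    by rewrite ler_sqr ?nnegrE ?enorm_ge0 ?mulr_ge0//; lra.
  by rewrite exprMn ler_wpM2r ?sqr_ge0// expr2 ler_piMr; lra.
apply: arcosh_lt; [|lra|].
  by rewrite lerDl; apply: divr_ge0; [rewrite mulr_ge0 ?sqr_ge0 | exact: ltW].
rewrite -ltrBrDl ltr_pdivrMr//.
have : d * a <= (ch e - 1) / 8 * a by rewrite ler_pM2r.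
have : d * ((1 - enorm y) ^+ 2 / 2) <= d * a by rewrite ler_pM2l.
have : 0 < (ch e - 1) * a by rewrite mulr_gt0.
lra.
Qed.

(** A single cover, at the finest scale, serves every layer
    [expR (- (j + 1)) < depth <= expR (- j)]: its centres carry boxes of radius [G expR (- j)],
    whose weighted volume is at most [M] for all [j]. This overcounting only costs the number of
    layers. *)
Lemma hvol_upper L z e : L `<=` usphere -> uball z -> 0 < e ->
  exists2 C : R, 0 < C & forall r s, 0 <= r -> is_cover (C^-1 * expR (- r)) L s ->
    (hvol (hball z r `&` hnbhd e (hull L)) <= (C * (r + 1) * (size s)%:R)%:E)%E.
Proof.
move=> LS bz e0.
have z1 : enorm z < 1 by rewrite enorm_lt1.
pose c := (1 - enorm z) / 5; have c0 : 0 < c by rewrite divr_gt0//; lra.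
have c1 : c <= 1 by rewrite /c; have := enorm_ge0 z; lra.
pose G := 14 * expR e + 1; have G0 : 0 < G by rewrite addr_gt0 ?mulr_gt0 ?expR_gt0.
pose M := (4 * expR 1 * G) ^+ n.+1; have M0 : 0 < M by rewrite exprn_gt0// !mulr_gt0 ?expR_gt0.
have lc : ln c <= 0 by apply: ln_le0.
(* [c^-1] makes the scale of the cover at most the depth of any point of the ball; the other term
   bounds [M] times the number of layers by [C (r + 1)]. *)
pose C := Num.max c^-1 ((1 - ln c) * M).
have C0 : 0 < C by rewrite lt_max invr_gt0 c0.
exists C => // r s r0 [s1 sL].
pose K := Num.truncn (r - ln c).
pose I := (nat * 'rV[R]_n.+1)%type.
have KM : (((size [seq (j, q) | j <- iota 0 K.+1, q <- s])%:R * M)%:E <=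
    (C * (r + 1) * (size s)%:R)%:E)%E.
  rewrite size_allpairs size_iota natrM lee_fin mulrAC ler_wpM2r//.
  apply: (@le_trans _ _ ((1 - ln c) * (r + 1) * M)); last first.
    by rewrite mulrAC ler_wpM2r ?le_max ?lexx ?orbT//; lra.
  rewrite ler_pM2r// -natr1.
  have /andP[h _] : K%:R <= r - ln c < K.+1%:R by apply: truncn_itv; lra.
  nra.
apply: le_trans KM.
apply: (@hvol_le_boxes R n.+1 _ I _ (fun jq => jq.2) (fun jq => G * expR (- jq.1%:R))
   (fun jq => (2 * expR 1 * expR jq.1%:R) ^+ n.+1)).
- by move=> x [[]].
- by move=> [j q]; rewrite mulr_ge0 ?expR_ge0 ?ltW.
- by move=> [j q]; rewrite exprn_ge0// !mulr_ge0 ?expR_ge0.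
- move=> [j q] /=; rewrite -exprMn /M lerXn2r ?nnegrE//.
  + by rewrite !mulr_ge0 ?expR_ge0 ?ltW.
  + by rewrite !mulr_ge0 ?expR_ge0 ?ltW.
  + have ee : expR j%:R * expR (- j%:R) = 1 :> R by rewrite -expRD subrr expR0.
    have -> : 2 * expR 1 * expR j%:R * (2 * (G * expR (- j%:R))) =
      4 * expR 1 * G * (expR j%:R * expR (- j%:R)) by ring.
    by rewrite ee mulr1.
move=> x [hx nx]; have [bx _] := hx.
have x1 : enorm x < 1 by rewrite enorm_lt1.
have xc := hball_depth bz hx; rewrite -/c in xc.
have a0 : 0 < 1 - enorm x by lra.
pose a := 1 - enorm x; rewrite -/a in a0 xc.
have a1 : a <= 1 by rewrite /a; have := enorm_ge0 x; lra.
have la : 0 <= - ln a by rewrite oppr_ge0 ln_le0.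
have lr : - ln a <= r - ln c.
  have : ln (c * expR (- r)) <= ln a by rewrite ler_ln ?posrE// mulr_gt0// expR_gt0.
  by rewrite lnM ?posrE ?expR_gt0// expRK; lra.
pose j := Num.truncn (- ln a).
have /andP[j1 j2] := truncn_itv la; rewrite -/j in j1 j2.
have jK : (j <= K)%N.
  by rewrite /K truncn_ge_nat; lra.
have aj : a <= expR (- j%:R).
  by rewrite -[leLHS]lnK ?posrE// ler_expR; lra.
have ja : expR (- j%:R) <= expR 1 * a.
  by rewrite -[a in leRHS]lnK ?posrE// -expRD ler_expR -natr1 in j2 *; lra.
have [y Ly yx] := hnbhd_near_limit_set LS e0 nx.
have [q qs qy] := sL y Ly.
exists (j, q).
  by apply/allpairsP; exists (j, q); split => //; rewrite mem_iota.
split=> /=.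
  apply: cbox_enorm; apply: le_trans (enorm_dist _ y _) _.
  have qy2 : enorm (y - q) <= a.
    rewrite enormB; apply: le_trans (enorm_le_sdist (s1 _ qs) (LS _ Ly)) _.
    apply: le_trans (ltW qy) _; apply: le_trans xc; rewrite ler_wpM2r ?expR_ge0//.
    by rewrite -[leRHS]invrK lef_pV2 ?posrE ?invr_gt0// le_max lexx.
  have : G * a <= G * expR (- j%:R) by rewrite ler_pM2l.
  by rewrite /G -/a in yx *; lra.
have d0 : a <= 1 - dotr x x by rewrite -sqr_enorm /a; have := enorm_ge0 x; nra.
apply: lerXn2r; rewrite ?nnegrE.
- by rewrite divr_ge0//; lra.
- by rewrite !mulr_ge0 ?expR_ge0.
rewrite ler_pdivrMr; last lra.
apply: (@le_trans _ _ (2 * (expR 1 * a) * expR j%:R)); last first.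
  rewrite -!mulrA ler_pM2l// ler_pM2l ?expR_gt0// mulrC ler_pM2l ?expR_gt0//.
have ee : expR (- j%:R) * expR j%:R = 1 :> R by rewrite -expRD addNr expR0.
have : expR (- j%:R) * expR j%:R <= expR 1 * a * expR j%:R by rewrite ler_pM2r ?expR_gt0.
by rewrite ee; lra.
Qed.

(** Over a separated subset of [L] the hull points [f x] at depth about [h] carry disjoint boxes of
    volume at least [M]. The volume thus bounds the size of such a subset, and a maximal one is a
    cover. *)
Lemma hvol_lower L z e : L `<=` usphere -> hull L !=set0 -> uball z -> 0 < e ->
  exists C r0 : R, [/\ 0 < C, 0 <= r0 & forall r, r0 <= r ->
    (covering_number (C * expR (- r)) L <=
     C%:E * hvol (hball z r `&` hnbhd e (hull L)))%E].
Proof.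
move=> LS L0 bz e0.
have z1 : enorm z < 1 by rewrite enorm_lt1.
have [d d0 hd] := hnbhd_ball e0.
have [h0 h00 hL] := hull_approach LS L0.
pose c := 20 / (1 - enorm z); have c0 : 0 < c by rewrite divr_gt0//; lra.
pose d' := Num.min 2^-1 d.
have d'0 : 0 < d' by rewrite lt_min d0 andbT.
have [d'1 d'2] : d' <= 2^-1 /\ d' <= d by split; rewrite ge_min lexx ?orbT.
have m0 : 0 < n.+1%:R :> R by rewrite ltr0n.
pose rho := d' / (3 * n.+1%:R); have rho0 : 0 < rho by rewrite divr_gt0 ?mulr_gt0.
have rhoE : n.+1%:R * rho = d' / 3 by rewrite /rho; field; lra.
(* On a box [1 - |y|^2 <= 6 h], so the density is at least [(2 / (6 h)) ^+ n.+1] on a cube of side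
   [2 rho h]. *)
pose M := (2 / 3 * rho) ^+ n.+1; have M0 : 0 < M by rewrite exprn_gt0// mulr_gt0.
(* [216 c expR (- r)] is [36 h]: separation [9 h], times 4 to pass from chords to spherical
   distance. *)
pose C := Num.max (216 * c) M^-1.
have [C1 C2] : 216 * c <= C /\ M^-1 <= C by split; rewrite le_max lexx ?orbT.
have C0 : 0 < C by apply: lt_le_trans C1; rewrite mulr_gt0.
exists C, (Num.max 0 (ln (6 * c / h0))); split; rewrite ?le_max ?lexx// => r.
rewrite ge_max => /andP[r0 r1].
(* The depth of [f x] is at least [h / 3], so the points of its box have depth at least
   [h / 6 = c expR (- r)], as [depth_hball] requires. *)
pose h := 6 * c * expR (- r); have hp : 0 < h by apply: mulr_gt0 (expR_gt0 _); apply: mulr_gt0.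
have hh0 : h <= h0.
  have u0 : 0 < 6 * c / h0 by apply: divr_gt0 => //; apply: mulr_gt0.
  have : 6 * c / h0 <= expR r by rewrite -[leLHS](@lnK R) ?ler_expR// posrE.
  rewrite ler_pdivrMr// => h1.
  by rewrite /h expRN ler_pdivrMr ?expR_gt0// [leRHS]mulrC.
set A := _ `&` _; set V := hvol A.
have [f hf] : exists f : 'rV[R]_n.+1 -> 'rV[R]_n.+1, forall x, L x -> [/\ hull L (f x),
    enorm (f x - x) <= 3 * h & h / 3 <= 1 - enorm (f x) <= 2 * h].
  have /choice[f hf] : forall x, exists y, L x -> [/\ hull L y,
      enorm (y - x) <= 3 * h & h / 3 <= 1 - enorm y <= 2 * h].
    move=> x; have [Lx|nL] := pselect (L x); last by exists 0.
    by have [y hy] := hL x h Lx hp hh0; exists y.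
  by exists f.
have boxE x y : cbox (f x) (rho * h) y -> enorm (y - f x) <= d' / 3 * h.
  by move=> xy; rewrite -rhoE -mulrA; apply: enorm_cbox xy; rewrite mulr_ge0 ?ltW.
have sep s : uniq s -> (forall x, x \in s -> L x) ->
    (forall x y, x \in s -> y \in s -> enorm (x - y) < 9 * h -> x = y) ->
    (((size s)%:R * M)%:E <= V)%E.
  move=> us sL sd.
  have fd x y q : x \in s -> y \in s -> cbox (f x) (rho * h) q -> cbox (f y) (rho * h) q -> x = y.
    move=> xs ys /boxE xq /boxE yq; apply: sd => //.
    have [_ fx _] := hf _ (sL _ xs); have [_ fy _] := hf _ (sL _ ys).
    (* If two boxes meet, [|x - y| <= 3 h + 2 (d' / 3) h + 3 h], which is less than [9 h]. *)
    have h1 := enorm_dist x (f x) y; have h2 := enorm_dist (f x) (f y) y.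
    have h3 := enorm_dist (f x) q (f y); rewrite (enormB (f x) q) in h3.
    rewrite (enormB x (f x)) in h1.
    have h4 : d' / 3 * h <= 2^-1 / 3 * h by rewrite ler_pM2r//; lra.
    lra.
  rewrite -(size_map f); apply: (@hvol_ge_boxes R n.+1 A _ (rho * h) M).
  - by move=> x [[]].
  - rewrite map_inj_in_uniq// => x y xs ys fxy; apply: (fd x y (f x)) => //.
      by move=> i; rewrite subrr normr0 mulr_ge0 ?ltW.
    by move=> i; rewrite fxy subrr normr0 mulr_ge0 ?ltW.
  - by rewrite mulr_gt0.
  - exact: ltW.
  - move=> _ y /mapP[x xs ->] /boxE xy; have [Hx _ /andP[f1 f2]] := hf _ (sL _ xs).
    have bx := hull_uball Hx.
    have q1 : enorm (y - f x) <= d' * (1 - enorm (f x)).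
      apply: le_trans xy _; rewrite -mulrA ler_pM2l//; lra.
    have q2 : d' * (1 - enorm (f x)) <= 2^-1 * (1 - enorm (f x)) by rewrite ler_pM2r; lra.
    have q3 := enorm_le_dist y (f x).
    have q4 := enorm_le_dist (f x) y; rewrite (enormB (f x)) in q4.
    have y1 : enorm y < 1 by lra.
    have by_ : uball y by rewrite /uball/= -enorm_lt1.
    split; first split.
    + apply: depth_hball => //; rewrite -/c; rewrite /h in f1; lra.
    + apply: hd bx Hx _; apply: le_trans q1 _; rewrite ler_pM2r//; lra.
    rewrite -exprMn /M; apply: lerXn2r; rewrite ?nnegrE.
    + by rewrite mulr_ge0 ?ltW.
    + have y2 : 0 < 2 / (1 - dotr y y) by apply: divr_gt0; rewrite ?subr_gt0.
      by apply: mulr_ge0 (ltW y2) (mulr_ge0 _ (mulr_ge0 (ltW rho0) (ltW hp))).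
    have y0 := enorm_ge0 y.
    rewrite -sqr_enorm [leRHS]mulrAC ler_pdivlMr; last by nra.
    have q5 : 1 - enorm y ^+ 2 <= 6 * h by nra.
    have : 2 / 3 * rho * (1 - enorm y ^+ 2) <= 2 / 3 * rho * (6 * h) by rewrite ler_pM2l// mulr_gt0.
    lra.
  - by move=> _ _ q /mapP[x xs ->] /mapP[y ys ->] h1 h2; rewrite (fd x y q).
have V0 : (0 <= V)%E by have := sep [::] isT; rewrite mul0r; apply.
have [Voo|Vfin] := eqVneq V +oo%E; first by rewrite Voo gt0_muley ?leey// lte_fin.
have [v vE] : exists v, V = v%:E by exists (fine V); rewrite fineK// ge0_fin_numE// ltey.
have v0 : 0 <= v by rewrite -lee_fin -vE.
rewrite vE in sep *.
have h9 : 0 < 9 * h by apply: mulr_gt0.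
have [||s [us sL sd sc]] := @exists_maximal_separated R n L (9 * h) (Num.truncn (v / M)).
- move=> s us sL sd; have := sep s us sL sd; rewrite lee_fin => hs.
  by rewrite truncn_ge_nat; [rewrite [leRHS]mulrC ler_pdivlMl 1?mulrC|exact: divr_ge0 v0 (ltW M0)].
- exact: h9.
apply: (@le_trans _ _ ((size s)%:R)%:E).
  apply: covering_number_le; apply: is_cover_enorm => //.
    by move=> x /sL /LS.
  move=> x Lx; have [y ys xy] := sc x Lx; exists y => //.
  apply: (@lt_le_trans _ _ (36 * h)); first lra.
  have : 216 * c * expR (- r) <= C * expR (- r) by rewrite ler_pM2r ?expR_gt0.
  rewrite /h; lra.
have := sep s us sL sd; rewrite !lee_fin => hs.
have h1 : (size s)%:R <= M^-1 * v by rewrite mulrC ler_pdivlMr.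
by apply: le_trans h1 _; rewrite ler_wpM2r.
Qed.

End HyperbolicEstimates.

(** * Growth rates *)

Section LimsupGrowthRate.
Context {R : realType}.
Implicit Types (a b t : R) (x y : \bar R).

Lemma lee_lt_real x y : (forall a, (y < a%:E)%E -> (x <= a%:E)%E) -> (x <= y)%E.
Proof.
case: y => [r| |] h; last 2 first.
- exact: leey.
- case: x h => [t| |] h //.
    have := h (t - 1) (ltNyr _); rewrite lee_fin => h1; exfalso; lra.
  by have := h 0 (ltNyr _); rewrite leye_eq.
apply/lee_addgt0Pr => t t0; rewrite -EFinD; apply: h.
by rewrite lte_fin; lra.
Qed.

Lemma lne_le_ln x t : 0 < t -> (x <= t%:E)%E -> (lne x <= (ln t)%:E)%E.
Proof.
move=> t0 xt; have [x0|x0] := leP x 0%E; first by rewrite le0_lneNy ?leNye.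
by rewrite -lne_EFin// lee_lne// in_itv/= ?lee_fin ltW//= ?leey.
Qed.

Lemma le_expR_lne x t : (lne x <= t%:E)%E -> (x <= (expR t)%:E)%E.
Proof.
have [x0 _|x0 xt] := leP x 0%E; first by apply: le_trans x0 _; rewrite lee_fin expR_ge0.
rewrite leNgt; apply/negP => h.
have : (lne (expR t)%:E < lne x)%E.
  by rewrite lte_lne// in_itv/= ?lee_fin ?expR_ge0 ?(ltW x0) leey.
by rewrite lne_EFin ?expR_gt0// expRK ltNge xt.
Qed.

Lemma limf_esup_le_near {T : choiceType} {X : filteredType T} (f : X -> \bar R)
    (F : set_system X) x :
  (\forall u \near F, (f u <= x)%E) -> (limf_esup f F <= x)%E.
Proof.
move=> h; rewrite limf_esupE.
apply: (@le_trans _ _ (ereal_sup (f @` [set u | (f u <= x)%E]))).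
  by apply: ereal_inf_lbound; exists [set u | (f u <= x)%E].
by apply: ge_ereal_sup => _ [u hu <-].
Qed.

Lemma near_le_limf_esup {T : choiceType} {X : filteredType T} (f : X -> \bar R)
    (F : set_system X) x :
  Filter F -> (limf_esup f F < x)%E -> \forall u \near F, (f u <= x)%E.
Proof.
move=> FF; rewrite limf_esupE => /ereal_inf_lt[_ [V FV <-] Vx].
apply: filterS FV => u Vu; apply: le_trans (ltW Vx).
by apply: ereal_sup_ubound; exists u.
Qed.

(** Serves both limits superior, with [g] equal to [r] for the entropy and to [- ln d] for the
    dimension; [a] is negligible because [g] tends to infinity. *)
Lemma limf_esup_rate_le {T : choiceType} {X : filteredType T} (f : X -> \bar R)
  (g : X -> R) (F : set_system X) a b :
  Filter F -> (forall M, \forall u \near F, M <= g u) ->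
  (\forall u \near F, (f u <= (a + b * g u)%:E)%E) ->
  (limf_esup (fun u => (f u * ((g u)^-1)%:E)%E) F <= b%:E)%E.
Proof.
move=> FF goo fg; apply/lee_addgt0Pr => e e0; apply: limf_esup_le_near.
have g1 := goo 1; have g2 := goo (a / e).
apply: filterS3 fg g1 g2 => u h1 h2 h3.
have g0 : 0 < g u by lra.
apply: (@le_trans _ _ ((a + b * g u)%:E * ((g u)^-1)%:E)%E).
  by apply: lee_wpmul2r h1; rewrite lee_fin invr_ge0 ltW.
rewrite -EFinM -EFinD lee_fin ler_pdivrMr//.
by move: h3; rewrite ler_pdivrMr//; lra.
Qed.

Lemma near_le_limf_esup_rate {T : choiceType} {X : filteredType T} (f : X -> \bar R)
  (g : X -> R) (F : set_system X) a :
  Filter F -> (forall M, \forall u \near F, M <= g u) ->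
  (limf_esup (fun u => (f u * ((g u)^-1)%:E)%E) F < a%:E)%E ->
  \forall u \near F, (f u <= (a * g u)%:E)%E.
Proof.
move=> FF goo /near_le_limf_esup h; have g1 := goo 1.
apply: filterS2 h g1 => u h1 h2.
have g0 : 0 < g u by lra.
have := lee_wpmul2r (ltW g0 : (0%:E <= (g u)%:E)%E) h1.
by rewrite -muleA -!EFinM mulVf ?gt_eqF// mule1.
Qed.

Lemma ln_le_subr1 t : 0 < t -> ln t <= t - 1.
Proof. by move=> t0; rewrite -[in leLHS](subrKC 1 t) le_ln1Dx//; lra. Qed.

Lemma near_pinfty_le M : \forall r \near +oo, M <= r :> R.
Proof. by apply: nbhs_pinfty_ge; rewrite num_real. Qed.

Lemma near0_le_ln (M : R) : \forall d \near 0^'+, M <= - ln d.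
Proof.
have h1 := nbhs_right_lt (expR_gt0 (- M)); have h2 := nbhs_right_gt (0 : R).
apply: filterS2 h1 h2 => d d1 d0.
by rewrite lerNr -[leRHS]expRK ler_ln ?posrE ?expR_gt0 ?ltW.
Qed.

End LimsupGrowthRate.

(** * Equality of entropy and dimension, and the dimension of porous sets *)

Section EntropyDimension.
Context {R : realType} {n : nat}.
Implicit Types (L : set 'rV[R]_n.+1) (z : 'rV[R]_n.+1) (e : R).

Lemma covering_number_nat L d : L `<=` usphere -> L !=set0 -> 0 < d ->
  exists2 s, is_cover d L s & covering_number d L = ((size s)%:R)%:E /\ 1 <= (size s)%:R :> R.
Proof.
move=> LS L0 d0; have [s cs sN] := covering_number_attained LS d0; exists s => //; split=> //.
by rewrite -lee_fin -sN covering_number_ge1.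
Qed.

Lemma hull_nonempty_limit_set L : L `<=` usphere -> hull L !=set0 -> L !=set0.
Proof. by move=> LS [x Hx]; have [y [z [Ly _ _]]] := hull_two_points LS Hx; exists y. Qed.

Lemma entropyE z e L : hull L !=set0 -> convex_core_entropy z e L =
  limf_esup (fun r : R => lne (hvol (hball z r `&` hnbhd e (hull L))) * (r^-1)%:E)%E
    (pinfty_nbhs R).
Proof.
by move=> /set0P/eqP H0; rewrite /convex_core_entropy asboolF.
Qed.

Lemma upper_box_dimE L : L !=set0 -> upper_box_dim L =
  limf_esup (fun d : R => lne (covering_number d L) * ((- ln d)^-1)%:E)%E 0^'+.
Proof. by move=> /set0P/eqP H0; rewrite /upper_box_dim asboolF. Qed.

Lemma upper_box_dim_le_entropy z e L : L `<=` usphere -> hull L !=set0 ->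
  uball z -> 0 < e -> (upper_box_dim L <= convex_core_entropy z e L)%E.
Proof.
move=> LS L0 bz e0; have LN := hull_nonempty_limit_set LS L0.
have [C [r0 [C0 r00 hC]]] := hvol_lower LS L0 bz e0.
apply: lee_lt_real => a; rewrite entropyE// upper_box_dimE//.
move=> /near_le_limf_esup_rate h.
have [M [_ hM]] := h near_pinfty_le.
pose M' := Num.max (M + 1) r0.
apply: (@limf_esup_rate_le _ _ _ _ _ _ (ln C + a * ln C)); first exact: near0_le_ln.
have h1 := near0_le_ln (M' - ln C); have h2 := nbhs_right_gt (0 : R).
apply: filterS2 h1 h2 => d d1 d0.
(* The radius at which the scale [C * expR (- r)] of the volume bound equals [d]. *)
pose r := ln C - ln d.
have dE : C * expR (- r) = d.
  by rewrite /r opprB expRD expRN !lnK ?posrE// mulrCA mulfV ?mulr1//; lra.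
have [r1 r2] : M < r /\ r0 <= r.
  have : M' <= r by rewrite /r; lra.
  by rewrite /M' ge_max => /andP[? ?]; split; lra.
have := hC r r2; have := le_expR_lne (hM r r1); rewrite dE.
have [s _ [-> s1]] := covering_number_nat LS LN d0.
set V := hvol _ => V1 V2.
have : ((size s)%:R <= C * expR (a * r)).
  rewrite -lee_fin EFinM; apply: le_trans V2 _.
  by apply: lee_wpmul2l V1; rewrite lee_fin ltW.
have s0 : 0 < (size s)%:R :> R by lra.
move=> h3; rewrite lne_EFin// lee_fin.
have : ln (size s)%:R <= ln (C * expR (a * r)).
  by rewrite ler_ln ?posrE// mulr_gt0 ?expR_gt0.
by rewrite lnM ?posrE ?expR_gt0// expRK /r; lra.
Qed.

Lemma entropy_le_upper_box_dim z e L : L `<=` usphere -> hull L !=set0 ->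
  uball z -> 0 < e -> (convex_core_entropy z e L <= upper_box_dim L)%E.
Proof.
move=> LS L0 bz e0; have LN := hull_nonempty_limit_set LS L0.
have [C C0 hC] := hvol_upper LS bz e0.
apply: lee_lt_real => a; rewrite entropyE// upper_box_dimE//.
move=> /near_le_limf_esup_rate h.
have [D /= D0 hD] := h near0_le_ln.
apply/lee_addgt0Pr => t t0; rewrite -EFinD.
(* The factor [r + 1] is absorbed by [ln (r + 1) <= t (r + 1) - 1 - ln t], at the price of the rate
   [t]. *)
apply: (@limf_esup_rate_le _ _ _ _ _ _ (ln C + (t - 1 - ln t) + a * ln C)).
  exact: near_pinfty_le.
have h1 := near_pinfty_le (0 : R); have h2 := near_pinfty_le (- ln C - ln D + 1).
apply: filterS2 h1 h2 => r r0 r1.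
pose d := C^-1 * expR (- r).
have d0 : 0 < d by rewrite mulr_gt0 ?invr_gt0 ?expR_gt0.
have lnd : - ln d = ln C + r by rewrite lnM ?posrE ?invr_gt0 ?expR_gt0// lnV ?posrE// expRK; lra.
have dD : d < D by rewrite -ltr_ln ?posrE//; lra.
have := hD d; rewrite /= sub0r normrN gtr0_norm// => /(_ dD d0).
have [s cs [-> s1]] := covering_number_nat LS LN d0.
have s0 : 0 < (size s)%:R :> R by lra.
rewrite lne_EFin// lee_fin lnd => h3.
have t1 : 0 < r + 1 by lra.
apply: le_trans (lne_le_ln _ (hC r s r0 cs)) _.
  by rewrite !mulr_gt0.
rewrite lee_fin !lnM ?posrE ?mulr_gt0//.
have : ln (t * (r + 1)) <= t * (r + 1) - 1 by apply: ln_le_subr1; rewrite mulr_gt0.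
rewrite lnM ?posrE//; lra.
Qed.

(** Two points of [L] would span a chord in the hull, so a non-empty [L] is one point, all its
    covering numbers are 1 and their logarithms vanish. *)
Lemma hull0_upper_box_dim L : L `<=` usphere -> hull L = set0 -> upper_box_dim L = 0%E.
Proof.
move=> LS H0; have [->|/set0P[p Lp]] := eqVneq L set0.
  by rewrite /upper_box_dim asboolT.
have LN : L !=set0 by exists p.
have Lp1 q : L q -> q = p.
  move=> Lq; apply: contrapT => qp.
  have : hull L (ball_point (1 + 1) (1 *: q + 1 *: p)) by apply: ideal_chord_sub_hull.
  by rewrite H0.
rewrite upper_box_dimE//.
have N1 d : 0 < d -> covering_number d L = 1%E.
  move=> d0; apply/eqP; rewrite eq_le covering_number_ge1// andbT.
  apply: (@covering_number_le _ _ _ _ [:: p]); split=> [c|x Lx].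
    by rewrite inE => /eqP ->; exact: LS.
  exists p; rewrite ?mem_head// (Lp1 _ Lx) /sdist.
  by have -> : dotr p p = 1 by [exact: LS]; rewrite acos1.
have E0 d : 0 < d -> (lne (covering_number d L) * ((- ln d)^-1)%:E = 0)%E.
  by move=> d0; rewrite N1// lne1 mul0e.
apply/eqP; rewrite eq_le; apply/andP; split.
  by apply: limf_esup_le_near; apply: filterS (nbhs_right_gt (0 : R)) => d d0; rewrite E0.
rewrite limf_esupE; apply: le_ereal_inf_tmp => _ [V FV <-].
have [d [Vd d0]] : exists d, V d /\ 0 < d.
  have : \forall d \near 0^'+, V d /\ (0 : R) < d.
    by apply: filterI => //; exact: nbhs_right_gt.
  by move=> /filter_ex.
by rewrite -(E0 d d0); apply: ereal_sup_ubound; exists d.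
Qed.

Lemma exists_pow2_between (x : R) : 1 <= x -> exists a : nat, x < 2 ^+ a <= 2 * x.
Proof.
move=> x1; have x0 : 0 < x by lra.
have ex : exists a, x < 2 ^+ a.
  have := exists_pow2_lt (a := x^-1); rewrite invr_gt0 => /(_ x0)[a].
  by rewrite exprVn ltf_pV2 ?posrE ?exprn_gt0// => ?; exists a.
case: (ex_minnP ex) => -[|a] xa amin; first by rewrite expr0 in xa; lra.
exists a.+1; rewrite xa/= exprS ler_pM2l// leNgt; apply/negP => /amin.
by rewrite ltnn.
Qed.

Lemma upper_box_dim_porous L (E s0 : R) (a : nat) : (1 <= n)%N -> L `<=` usphere ->
  L !=set0 -> 1 <= E -> 0 < s0 -> 32 * n.+1%:R ^+ 2 * E < 2 ^+ a ->
  (forall x s, L x -> 0 < s -> s <= s0 -> exists y, [/\ usphere y, enorm (y - x) <= s &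
     forall z, L z -> s / E <= enorm (z - y)]) ->
  (upper_box_dim L <= (n%:R - 2^-1 * 2^-1 ^+ a ^+ n)%:E)%E.
Proof.
move=> n1 LS LN E1 s00 aE por.
have [k0 /ltW hk0] := exists_pow2_lt s00.
have [K K0 hK] := size_cover_points_porous LS E1 por hk0 aE n1.
set q := _ * _ ^+ a in hK; set l := 2 ^+ n * _ in hK.
have b1 : 2^-1 ^+ n <= 2^-1 :> R.
  by case: n n1 => // m _; rewrite exprS ler_piMr// exprn_ile1//; lra.
have b0 : 0 < 2^-1 ^+ n :> R by rewrite exprn_gt0.
have u0 : 0 < 2^-1 ^+ n ^+ a :> R by rewrite exprn_gt0.
have u1 : 2^-1 ^+ n ^+ a <= 1 :> R by rewrite exprn_ile1//; lra.
have bb : 2 ^+ n * 2^-1 ^+ n = 1 :> R by rewrite -exprMn mulfV ?expr1n.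
have q1 : q < 1 by rewrite /q; nra.
have qu : 2^-1 * 2^-1 ^+ a ^+ n <= q by rewrite exprAC /q ler_pM2r; lra.
(* Needed for [0 <= ln l], so that [k] can be replaced by its real upper bound in [k * ln l]. *)
have l1 : 1 <= l.
  have p0 : 0 < 2 ^+ n :> R by rewrite exprn_gt0.
  have : 2 ^+ n * (1 - 2^-1 ^+ n) * 2^-1 ^+ n ^+ a <= 2 ^+ n * (1 - 2^-1 ^+ n) :> R.
    by rewrite ler_piMr//; apply: mulr_ge0; lra.
  have -> : l = 2 ^+ n - 2 ^+ n * (1 - 2^-1 ^+ n) * 2^-1 ^+ n ^+ a by rewrite /l /q; ring.
  by rewrite mulrBr bb mulr1; lra.
have l0 : 0 < l by lra.
have ll : 0 <= ln l by rewrite ln_ge0.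
have l2 : 0 < ln 2 :> R by rewrite ln_gt0//; lra.
have l21 : ln 2 <= 1 :> R by have := @ln_le_subr1 R 2; lra.
rewrite upper_box_dimE//.
(* [ln l / ln 2 = n + ln (1 - q) / ln 2], and this is at most [n - q] because [ln (1 - q) <= - q]
   and [0 < ln 2 <= 1]. *)
apply: (@le_trans _ _ (ln l / ln 2)%:E); last first.
  rewrite lee_fin ler_pdivrMr// /l lnM ?posrE ?exprn_gt0//; last lra.
  have h1 : ln (1 - q) <= - q by have := @ln_le_subr1 _ (1 - q); lra.
  rewrite lnXn// -[ln 2 *+ n]mulr_natl; set v := 2^-1 * _ in qu *.
  have : v * ln 2 <= q * ln 2 by rewrite ler_pM2r.
  have : q * ln 2 <= q by apply: ler_piMr => //; rewrite /q; apply: mulr_ge0; lra.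
  lra.
pose m8 : R := 8 * n.+1%:R; have m80 : 0 < m8 by rewrite mulr_gt0.
apply: (@limf_esup_rate_le _ _ _ _ _ _ (ln K + (ln m8 / ln 2 + 1) * ln l)).
  exact: near0_le_ln.
have h1 := near0_le_ln (0 : R); have h2 := nbhs_right_gt (0 : R).
have h3 := nbhs_right_lt m80.
apply: filterS3 h1 h2 h3 => d d1 d0 d2.
have t0 : 0 <= (ln m8 - ln d) / ln 2.
  by apply: divr_ge0 (ltW l2); rewrite subr_ge0 ler_ln ?posrE// ltW.
pose k := (Num.truncn ((ln m8 - ln d) / ln 2)).+1.
have /andP[k1 k2] := truncn_itv t0; rewrite -/k in k2.
have kd : 8 * n.+1%:R * 2^-1 ^+ (k0 + k) < d.
  apply: (@le_lt_trans _ _ (m8 * 2^-1 ^+ k)).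
    rewrite ler_pM2l// exprD ler_piMl ?exprn_ge0// exprn_ile1//; lra.
  rewrite exprVn ltr_pdivrMr ?exprn_gt0// mulrC -ltr_pdivrMr//.
  rewrite -ltr_ln ?posrE ?exprn_gt0 ?divr_gt0// ln_div ?posrE// lnXn//.
  by rewrite -[ltRHS]mulr_natl -ltr_pdivrMr.
have := covering_number_le (is_cover_cover_points LS kd).
have [s _ [-> s1]] := covering_number_nat LS LN d0.
rewrite lee_fin => /le_trans/(_ (hK k)) h.
have s0' : 0 < (size s)%:R :> R by apply: lt_le_trans s1.
rewrite lne_EFin// lee_fin.
have : ln (size s)%:R <= ln (K * l ^+ k) by rewrite ler_ln ?posrE ?mulr_gt0 ?exprn_gt0.
rewrite lnM ?posrE ?exprn_gt0// lnXn// -[ln l *+ k]mulr_natl.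
have h4 : k%:R * ln l <= ((ln m8 - ln d) / ln 2 + 1) * ln l.
  by rewrite ler_wpM2r// /k -[leLHS]natr1 lerD2r.
move=> h5; apply: le_trans h5 _; rewrite -addrA lerD2l; apply: le_trans h4 _.
have ringE (x y u v : R) : ((x - y) * u + 1) * v = (x * u + 1) * v + v * u * - y by ring.
by rewrite ringE.
Qed.

End EntropyDimension.

Theorem theorem3p12 (R : realType) (n : nat) (n_ge1 : (1 <= n)%N) :
  exists C : R, 0 < C /\
    forall (l : R) (L : set 'rV[R]_n.+1),
      0 <= l -> closed L -> L `<=` usphere -> tight l L ->
      (forall (z : 'rV[R]_n.+1) (e : R), uball z -> 0 < e ->
         convex_core_entropy z e L = upper_box_dim L) /\
      (upper_box_dim L <= (n%:R - C * expR (- (2 * n%:R * l)))%:E)%E.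
Proof.
(* The depth [a] of the subcube will satisfy [2^a <= 2 * 32 (n+1)^2 * (60 expR l)^2 = c * expR l ^+
   2]; the n-th power of the inverse gives the final bound. *)
pose c : R := (8 * n.+1%:R * 60) ^+ 2.
have m1 : 1 <= n.+1%:R :> R by rewrite ler1n.
have c1 : 1 <= c by rewrite /c expr_ge1//; lra.
have c0 : 0 < c by lra.
exists (2^-1 * c^-1 ^+ n); split.
  by rewrite mulr_gt0 ?exprn_gt0 ?invr_gt0.
move=> l L l0 _ LS tL.
(* With an empty hull both quantities are 0, and it only remains to see that the subtracted term is
   at most [1 <= n]. *)
have [H0|/set0P HN] := eqVneq (hull L) set0.
  rewrite hull0_upper_box_dim//; split=> [z e _ _|].
    by rewrite /convex_core_entropy asboolT.
  rewrite lee_fin subr_ge0.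
  have h1 : 2^-1 * c^-1 ^+ n <= 1 :> R.
    rewrite mulr_ile1 ?exprn_ge0 ?invr_ge0 ?exprn_ile1 ?invf_le1 ?invr_ge0 ?(ltW c0)//; lra.
  have h2 : expR (- (2 * n%:R * l)) <= 1 by rewrite expR_le1 oppr_le0 !mulr_ge0.
  have h3 : 1 <= n%:R :> R by rewrite ler1n.
  apply: le_trans h3; have h4 := expR_ge0 (- (2 * n%:R * l)).
  apply: le_trans h2; apply: ler_piMl h4 h1.
have LN := hull_nonempty_limit_set LS HN.
split=> [z e bz e0|].
  by apply/eqP; rewrite eq_le entropy_le_upper_box_dim//= upper_box_dim_le_entropy.
have [s0 s00 por] := tight_porous n_ge1 l0 LS HN tL.
have e1 : 1 <= expR l by rewrite -expR0 ler_expR.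
set E := (60 * expR l) ^+ 2 in por.
have E1 : 1 <= E by rewrite /E expr_ge1//; lra.
have [a /andP[a1 a2]] : exists a : nat,
    32 * n.+1%:R ^+ 2 * E < 2 ^+ a <= 2 * (32 * n.+1%:R ^+ 2 * E).
  apply: exists_pow2_between; rewrite -[leLHS]mulr1; apply: ler_pM => //.
  by have : 1 <= n.+1%:R ^+ 2 :> R by [rewrite expr_ge1//]; lra.
apply: le_trans (upper_box_dim_porous n_ge1 LS LN E1 s00 a1 por) _.
rewrite lee_fin lerD2l lerN2 -[leLHS]mulrA ler_pM2l//.
have -> : c^-1 ^+ n * expR (- (2 * n%:R * l)) = (c^-1 * expR (- l) ^+ 2) ^+ n.
  rewrite exprMn -exprM -expRM_natr; congr (_ * expR _); rewrite natrM; lra.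
apply: lerXn2r; rewrite ?nnegrE ?exprn_ge0 ?invr_ge0//.
  by rewrite mulr_ge0 ?invr_ge0 ?exprn_ge0 ?expR_ge0 ?(ltW c0).
rewrite exprVn expRN exprVn -invfM lef_pV2 ?posrE ?exprn_gt0 ?mulr_gt0 ?expR_gt0//.
by apply: le_trans a2 _; rewrite /c /E !exprMn; lra.
Qed.
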